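(* Let $K$ be a function field of a curve over a finite field $\mathbb{F}_q$ of genus $g\in\{0,1\}$, and let $d \ge 2$ be an integer. Assume that $f \in \mathcal{O}_K$ satisfies $v(f) < d$ for all $v \in M_K$, and put $S = \{v \in M_K : v(f) > 0\}$. Let $\phi(z) = z^d + f^{-1} \in K[z]$. Then for all $s\in\mathbb{C}$ with $\mathrm{Re}(s)>2$ the dynamical height zeta function of $\phi$ is given by $$Z_K(\phi, s) = q^{1-g}\frac{\zeta_K(s-1)}{\zeta_K(s)} \prod_{v \in S} \frac{u_v^{v(f)} + (q_v - 1)u_v^d - q_v u_v^{d + v(f)}}{1 - u_v^d} + \frac{c(g)}{\zeta_K(s)} \prod_{v \in S} \frac{u_v^{v(f)} - u_v^d}{1 - u_v^d},$$ where $q_v = q^{f_v}$ is the cardinality of the residue field at $v$, $u_v = q^{-s f_v/d}=q_v^{-s/d}$, $c(0)=0$, and $c(1) = q-1$.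
   Context: $K$ is a function field in one variable with full constant field $\mathbb{F}_q$. $M_K$ is the set of all places of $K$; for $v\in M_K$, $v(\cdot)$ also denotes the normalized additive valuation (with $v(0)=+\infty$), $f_v$ is the residue degree over $\mathbb{F}_q$ and $q_v=q^{f_v}$ is the cardinality of the residue field. The normalized absolute value is $|x|_v=q_v^{-v(x)}$. $\mathcal{O}_K$ is the ring of integers of $K$ (the integral closure of $\mathbb{F}_q[t]$ in $K$, where $t\in K$ is a fixed element transcendental over $\mathbb{F}_q$). The height is $H_K(x)=\prod_{v\in M_K}\max\{1,|x|_v\}$ for $x\in K$. For a polynomial $\phi\in K[z]$ of degree $d\ge 2$ with $n$-th iterate $\phi^n$, the dynamical canonical height is $\widehat{H}_{\phi}(x)=\lim_{n\to\infty}H_K(\phi^n(x))^{1/d^n}$. The dynamical height zeta function is $Z_K(\phi,s)=\sum_{x\in K}\widehat{H}_\phi(x)^{-s}$ for $\mathrm{Re}(s)>2$. $\zeta_K(s)=\prod_{v\in M_K}(1-q_v^{-s})^{-1}$ is the Dedekind zeta function of $K$ (product over all places), together with its meromorphic continuation to $\mathbb{C}$. Empty products equal $1$. *)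

(* Defs.v *)
From HB Require Import structures.
From mathcomp Require Import all_boot all_order all_algebra all_field.
From mathcomp Require Import fraction complex finmap.
From mathcomp Require Import all_classical all_reals all_analysis.
From mathcomp.analysis.showcase Require summability.

Set Implicit Arguments.
Unset Strict Implicit.
Unset Printing Implicit Defensive.

Import Order.TTheory GRing.Theory Num.Theory.
Import numFieldNormedType.Exports.

Local Open Scope classical_set_scope.
Local Open Scope ring_scope.

Notation totally := summability.totally.
Notation partial_sum := summability.partial_sum.

(* A function field in one variable over F, with a chosen transcendental
   element t, is a finite extension K of F(t) = {fraction {poly F}}. *)
Definition const_emb (F : finFieldType) (K : fieldExtType {fraction {poly F}})
  : F -> K := in_alg K \o @tofrac {poly F} \o polyC.
HB.instance Definition _ (F : finFieldType)
    (K : fieldExtType {fraction {poly F}}) :=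
  GRing.RMorphism.copy (const_emb K) (in_alg K \o @tofrac {poly F} \o polyC).

Definition full_constant_field (F : finFieldType)
    (K : fieldExtType {fraction {poly F}}) : Prop :=
  forall x : K, algebraicOver (const_emb K) x ->
    exists c : F, x = const_emb K c.

Definition integers (F : finFieldType) (K : fieldExtType {fraction {poly F}}) :
    set K :=
  [set x | integralOver (in_alg K \o @tofrac {poly F}) x].
Arguments integers {F} K _.

Record normalized_valuation (K : fieldType) (v : K -> \bar int) : Prop := {
  nval_gtNy : forall x, v x != -oo%E;
  nval_eqy : forall x, v x = +oo%E <-> x = 0;
  nvalM : forall x y, v (x * y) = (v x + v y)%E;
  nvalD : forall x y, (Order.min (v x) (v y) <= v (x + y)%R)%E;
  nval_uniformizer : exists x, v x = 1%:E }.

(* Every valuation is trivial on the finite field F, so these are all the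
   places of K / F. *)
Definition place (F : finFieldType) (K : fieldExtType {fraction {poly F}}) :
    set (K -> \bar int) :=
  [set v | normalized_valuation v].
Arguments place {F} K _.

(* n is the F-dimension of the quotient V / W, for F-subspaces W of V of K:
   the n vectors b i lift a basis of V / W. *)
Definition is_quot_dim (F : finFieldType)
    (K : fieldExtType {fraction {poly F}}) (V W : set K) (n : nat) : Prop :=
  exists b : 'I_n -> K, (forall i, V (b i)) /\
    forall x, V x ->
      exists! c : 'rV[F]_n, W (x - \sum_(i < n) const_emb K (c 0 i) * b i).

Definition quot_dim (F : finFieldType) (K : fieldExtType {fraction {poly F}})
    (V W : set K) : nat :=
  xget 0%N [set n | is_quot_dim V W n].

Section Places.
Context (F : finFieldType) (K : fieldExtType {fraction {poly F}}).
Implicit Types (v : place K) (x : K) (D : place K -> int).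

Definition residue_degree v : nat :=
  quot_dim [set x | (0 <= val v x)%E] [set x | (0 < val v x)%E].

Definition residue_card v : nat := (#|F| ^ residue_degree v)%N.

Definition divisor D : Prop := finite_set [set v | D v != 0].

Definition divisor_degree D : int :=
  \sum_(v \in [set: place K]) D v * (residue_degree v)%:Z.

Definition riemann_roch_space D : set K :=
  [set x | forall v, ((- D v)%:E <= val v x)%E].

Definition ell D : nat := quot_dim (riemann_roch_space D) [set 0].

End Places.

(* The maximum of deg D - ell D + 1 over all divisors D is g. *)
Definition is_genus (F : finFieldType) (K : fieldExtType {fraction {poly F}})
    (g : nat) : Prop :=
  (forall D : place K -> int, divisor D ->
     divisor_degree D - (ell D)%:Z + 1 <= g%:Z) /\
  (exists D : place K -> int,
     divisor D /\ divisor_degree D - (ell D)%:Z + 1 = g%:Z).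

Section Heights.
Context (R : realType) (F : finFieldType).
Context (K : fieldExtType {fraction {poly F}}).
Implicit Types (v : place K) (x : K) (phi : {poly K}).

Definition absv v x : R :=
  if val v x is n%:E then (residue_card v)%:R ^ (- n) else 0.

(* The product is over the finitely many places where the factor is not 1. *)
Definition height x : R :=
  \big[*%R/1]_(v \in [set: place K]) Num.max 1 (absv v x).

Definition canonical_height phi x : R :=
  limn (fun n : nat => height (iter n (fun z => phi.[z]) x)
                         `^ ((((size phi).-1 ^ n)%N)%:R^-1)).

End Heights.

(* a ^ s = exp (s * ln a), for a > 0 *)
Definition cpow (R : realType) (a : R) (s : R[i]) : R[i] :=
  Complex (a `^ complex.Re s) 0 *
  Complex (cos (complex.Im s * ln a)) (sin (complex.Im s * ln a)).

Section Zeta.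
Context (R : realType) (F : finFieldType).
Context (K : fieldExtType {fraction {poly F}}).

Definition height_zeta_term (phi : {poly K}) (s : R[i]) (x : K) : R[i]^o :=
  cpow (canonical_height R phi x) (- s).

(* Unconditional sum over all x in K: limit of the partial sums along the
   finite subsets of K. *)
Definition height_zeta (phi : {poly K}) (s : R[i]) : R[i] :=
  summability.sum (height_zeta_term phi s).

(* The Euler product, whose limit for Re s > 1 is the value at s of the
   meromorphic continuation. When Re s > 2, both s and s - 1 lie in this
   half-plane, so that the continuation itself plays no role. *)
Definition dedekind_zeta (s : R[i]) : R[i] :=
  lim ((fun A : {fset place K} =>
          \prod_(v <- A) (1 - cpow (residue_card v)%:R (- s))^-1 : R[i]^o)
         @ totally).

Definition u_ (d : nat) (s : R[i]) (v : place K) : R[i] :=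
  cpow #|F|%:R (- (s * (residue_degree v)%:R / d%:R)).

End Zeta.

(* Main.v *)
Require Import Defs.
From HB Require Import structures.
From mathcomp Require Import all_boot all_order all_algebra all_field.
From mathcomp Require Import fraction complex finmap.
From mathcomp Require Import all_classical all_reals all_analysis.
From mathcomp Require Import zify ring lra.

(** Let q be the order of F.  The canonical height of x is a product of local
    factors that depend only on the pole orders of x.  At a place v with
    v(f) <= 0 the factor is q_v to the pole order.  At a place with v(f) > 0 it
    is the same if x has a pole, and q_v^(v(f)/d) otherwise: the first iterate
    then acquires a pole of order v(f), and every further step multiplies the
    pole order by d.  The inequality v(f) < d excludes any cancellation
    ([canonical_heightE]).  So the zeta function is the sum over x in K of a
    product of local weights of the pole orders of x.

    In genus at most one, Riemann-Roch counts the elements with polar divisor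
    at most D: for effective D their number is
    q^(1-g) q^(deg D) + c(g) [D = 0] ([card_rr_space_effective]).  Writing each
    local weight as the sum of its drops from the given pole order on, the sum
    over all x with poles in a finite set A of places and pole orders at most n
    becomes a combination of these numbers, and it factors as q^(1-g) times one
    product over A plus c(g) times another ([sum_over_box]).  The local factors
    are geometric sums.  Letting n and then A grow ([cvg_euler_sum]), they
    become the factors of zeta(s-1) / zeta(s), respectively 1 / zeta(s), times
    corrections at the zeros of f.

    The theory of function fields that enters is drawn from the definition of
    the genus as the maximum of deg D - ell D + 1.  If y is nonzero, the space
    of k div(y) is one-dimensional for every k, so deg(div y) <= 0
    ([deg_div_le0]).  In genus one, ell(v) = deg(v) + 1 would propagate to
    ell(kv) = k deg(v) + 1 by taking products, against the existence of a
    divisor with ell D = deg D ([ell_place_genus1]).  Counting nonzero elements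
    that vanish at a given place shows that there are O(q^n) places of degree n
    ([count_places]), hence that the Euler products converge ([euler_product],
    [sum_residue_card]).  For this one needs that some place exists, that
    residue degrees are finite and that zeros are finite in number.  All three
    rest on one dependence statement, which says for transcendental x that K is
    finite over F(x), and which follows from the pigeonhole principle because F
    is finite ([poly_relation]).  A place is obtained from a maximal subring in which t
    is not invertible; it is a valuation ring, and it is discrete because
    elements with distinct values below that of t are independent over F[t]
    ([value_chain_bound]). *)

Set Implicit Arguments.
Unset Strict Implicit.
Unset Printing Implicit Defensive.
Import Order.TTheory GRing.Theory Num.Theory.
Import numFieldNormedType.Exports.
Local Open Scope classical_set_scope.
Local Open Scope ring_scope.

(** * Algebraic dependence by counting *)
Section LinearRelations.
Context (F : finFieldType) (K : fieldExtType {fraction {poly F}}).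
Implicit Types (x y z : K) (h : {poly F}) (m n : nat).

Local Notation N := (\dim {:K}).
Local Notation b := (vbasis {:K}).
Local Notation "h '%:FF'" := (@tofrac {poly F} h) (at level 2).

Lemma frac_denominator (r : {fraction {poly F}}) :
  exists2 h, h != 0 & exists c, h%:FF * r = c%:FF.
Proof.
rewrite -[r]reprK; case: (repr r) => -[n d] /= d0.
exists d => //; exists n.
have fE p : p%:FF = \pi_(FracField.type {poly F})%qT (Ratio p 1).
  by rewrite /FracField.tofrac; unlock.
rewrite !fE -[_ * _]/(FracField.mul _ _) -FracField.pi_mul.
apply/eqP; rewrite FracField.equivf_def /FracField.mulf.
rewrite !numden_Ratio ?mulf_neq0 ?oner_neq0 //=.
by rewrite !mul1r !mulr1 mulrC.
Qed.

(** With respect to the fixed basis [b] of [K] over F(t), the elements whose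
    coordinates are polynomials in t of degree less than [m].  Up to
    denominators this is an exhaustive filtration of [K] by finite sets whose
    logarithmic size grows linearly in [m]. *)
Definition poly_box m : set K :=
  [set z | exists2 c : 'I_N -> {poly F}, forall j, (size (c j) <= m)%N &
           z = \sum_j (c j)%:FF *: b`_j].

Lemma poly_box0 m : poly_box m 0.
Proof.
exists (fun=> 0) => [j|]; first by rewrite size_poly0.
by rewrite big1 // => j _; rewrite rmorph0 scale0r.
Qed.

Lemma poly_boxD m x y : poly_box m x -> poly_box m y -> poly_box m (x + y).
Proof.
move=> [c hc ->] [c' hc' ->]; exists (fun j => c j + c' j) => [j|].
  by rewrite (leq_trans (size_polyD _ _)) // geq_max hc hc'.
by rewrite -big_split /=; apply: eq_bigr => j _; rewrite rmorphD scalerDl.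
Qed.

Lemma poly_box_sum m (I : Type) (r : seq I) (P : pred I) (G : I -> K) :
  (forall i, P i -> poly_box m (G i)) -> poly_box m (\sum_(i <- r | P i) G i).
Proof. by move=> hG; elim/big_ind: _ => //; [exact: poly_box0|exact: poly_boxD]. Qed.

Lemma poly_boxZ m h x : poly_box m x -> poly_box (m + size h) (h%:FF *: x).
Proof.
move=> [c hc ->]; exists (fun j => h * c j) => [j|].
  rewrite (leq_trans (size_polyMleq _ _)) // (leq_trans (leq_pred _)) //.
  by rewrite addnC leq_add2r.
by rewrite scaler_sumr; apply: eq_bigr => j _; rewrite scalerA rmorphM.
Qed.

Lemma poly_boxW m n x : (m <= n)%N -> poly_box m x -> poly_box n x.
Proof. by move=> mn [c hc xE]; exists c => // j; exact: leq_trans (hc j) mn. Qed.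

Lemma poly_box_family (I : finType) (y : I -> K) :
  exists2 h, h != 0 & exists m, forall i, poly_box m (h%:FF *: y i).
Proof.
have /choice[h0 hh0] (r : {fraction {poly F}}) :
    exists hc : {poly F} * {poly F}, hc.1 != 0 /\ hc.1%:FF * r = hc.2%:FF.
  by have [h h0 [c hc]] := frac_denominator r; exists (h, c).
pose H := \prod_(p : I * 'I_N) (h0 (coord b p.2 (y p.1))).1.
have H0 : H != 0 by apply/prodf_neq0 => p _; case: (hh0 (coord b p.2 (y p.1))).
have hH (i : I) j : exists c, H%:FF * coord b j (y i) = c%:FF.
  have [_ e] := hh0 (coord b j (y i)).
  rewrite /H (bigD1 (i, j)) //=; set R := \prod_(_ | _) _.
  exists (R * (h0 (coord b j (y i))).2).
  by rewrite !rmorphM /= -e mulrA [_%:FF * R%:FF]mulrC.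
have /choice[c hc] (p : I * 'I_N) := hH p.1 p.2.
exists H => //; exists (\max_p size (c p)) => i.
exists (fun j => c (i, j)) => [j|]; first exact: (leq_bigmax (i, j)).
rewrite {1}[y i](coord_vbasis (memvf _)) scaler_sumr; apply: eq_bigr => j _.
by rewrite scalerA (hc (i, j)).
Qed.

(** After a fixed denominator [h], multiplication by [x] raises degrees by a
    bounded amount [C]; padding by [h] alone is controlled by the same [C], so
    that all products [h ^+ n * x ^+ k] with [k <= n] behave alike. *)
Lemma poly_box_mul x : exists2 h, h != 0 & exists C, forall m z,
  poly_box m z -> poly_box (m + C) (h%:FF *: z) /\ poly_box (m + C) (h%:FF *: (x * z)).
Proof.
have [h h0 [C hC]] := poly_box_family (fun j : 'I_N => x * b`_j).
exists h => //; exists (size h + C)%N => m z mz; split.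
  by apply: poly_boxW (poly_boxZ h mz); rewrite addnA leq_addr.
case: mz => c hc ->; rewrite mulr_sumr scaler_sumr; apply: poly_box_sum => j _.
rewrite -scalerAr scalerA mulrC -scalerA.
apply: poly_boxW (poly_boxZ (c j) (hC j)).
by rewrite [X in (X <= _)%N]addnC leq_add ?leq_addl.
Qed.

(** Pigeonhole: for [M] large compared with the growth rate of [poly_box], the
    number of families of polynomials of degree less than [n] indexed by
    ['I_M.+1] eventually exceeds the size of the box that contains all their
    values, so two of them have the same value.  For transcendental [x] the
    statement says that [K] has finite degree over F(x). *)
Lemma poly_relation x : exists M, forall y : 'I_M.+1 -> K,
  exists a : 'I_M.+1 -> {poly F}, (exists i, a i != 0) /\
    \sum_i (map_poly (const_emb K) (a i)).[x] * y i = 0.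
Proof.
have [h h0 [C hC]] := poly_box_mul x.
exists (N * C)%N => y.
have [h' h'0 [m hm]] := poly_box_family y.
have xk n k i : (k <= n)%N ->
    poly_box (m + n * C) ((h ^+ n * h')%:FF *: (x ^+ k * y i)).
  elim: n k => [|n IH] k.
    by rewrite leqn0 => /eqP->; rewrite mul0n addn0 !expr0 !mul1r.
  rewrite leq_eqVlt ltnS => /predU1P[->|kn]; rewrite mulSn (addnC C) addnA.
    have [_] := hC _ _ (IH n (leqnn n)).
    by rewrite -scalerAr scalerA -rmorphM !exprS !mulrA.
  have [+ _] := hC _ _ (IH k kn).
  by rewrite scalerA -rmorphM exprS !mulrA.
(* this [n] is large enough for [N * (m + n * C) < (N * C + 1) * n] *)
pose n := (N * m).+1; pose M := (N * C)%N; pose B := (m + n * C)%N.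
pose val_ (a : {ffun 'I_M.+1 * 'I_n -> F}) : K :=
  \sum_p const_emb K (a p) * (x ^+ p.2 * y p.1).
have /choice[g hg] (a : {ffun 'I_M.+1 * 'I_n -> F}) :
    exists c : {ffun 'I_N * 'I_B -> F}, (h ^+ n * h')%:FF *: val_ a =
       \sum_j (\sum_(l < B) c (j, l) *: 'X^l)%:FF *: b`_j.
  have [c hc cE] : poly_box B ((h ^+ n * h')%:FF *: val_ a).
    rewrite /val_ scaler_sumr; apply: poly_box_sum => -[i k] _ /=.
    rewrite /const_emb /= -scalerAl mul1r scalerA mulrC -scalerA.
    have [c hc ->] := xk n k i (ltnW (ltn_ord k)).
    exists (fun j => (a (i, k)) *: c j) => [j|].
      by rewrite (leq_trans (size_scale_leq _ _)).
    rewrite scaler_sumr; apply: eq_bigr => j _.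
    by rewrite scalerA -rmorphM mul_polyC.
  exists [ffun p : 'I_N * 'I_B => (c p.1)`_p.2]; rewrite cE; apply: eq_bigr => j _.
  congr (_%:FF *: _); rewrite -[LHS]coefK (poly_def (size (c j))).
  under [RHS]eq_bigr do rewrite ffunE /=.
  rewrite (big_ord_widen B (fun l => (c j)`_l *: 'X^l)) // big_mkcond.
  apply: eq_bigr => l _; case: ifPn => //; rewrite -leqNgt => hl.
  by rewrite nth_default // scale0r.
have /injectivePn[a [a' naa' gaa']] : ~~ injectiveb g.
  apply/negP => /injectiveP /leq_card; rewrite !card_ffun !card_prod !card_ord.
  rewrite leq_exp2l ?finNzRing_gt1 // /M /B /n; nia.
have vaa' : val_ a = val_ a'.
  have H0 : (h ^+ n * h')%:FF != 0 by rewrite tofrac_eq0 mulf_neq0 ?expf_neq0.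
  by apply: (scalerI H0); rewrite !hg gaa'.
pose e i : {poly F} := \poly_(k < n) (if insub k is Some k' then a (i, k') - a' (i, k') else 0).
exists e; split.
  have [[i k] aik] : exists p, a p != a' p.
    apply/existsP; apply: contraNT naa' => /existsPn aa'.
    by apply/eqP/ffunP => p; have := aa' p; rewrite negbK => /eqP.
  exists i; apply: contraNneq aik => /polyP/(_ k).
  by rewrite coef_poly ltn_ord coef0 valK => /eqP; rewrite subr_eq0.
transitivity (\sum_i \sum_(k < n) const_emb K (a (i, k) - a' (i, k)) * (x ^+ k * y i)); last first.
  apply/esym.
  rewrite pair_bigA -[LHS](subrr (val_ a)) {2}vaa' /val_ -sumrB.
  by apply: eq_bigr => -[i k] _; rewrite rmorphB mulrBl.
apply: eq_bigr => i _.
have se : (size (map_poly (const_emb K) (e i)) <= n)%N.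
  by rewrite (leq_trans (size_poly _ _)) // size_poly.
rewrite (horner_coef_wide _ se).
rewrite mulr_suml; apply: eq_bigr => k _.
by rewrite coef_map coef_poly ltn_ord valK mulrA.
Qed.

(** Dividing by the largest common power of the variable, some coefficient of
    the relation does not vanish at 0.  Reduction modulo a place where [x] has
    a zero then gives a nontrivial relation with constant coefficients. *)
Lemma poly_relation_at0 x : x != 0 -> exists M, forall y : 'I_M.+1 -> K,
  exists a : 'I_M.+1 -> {poly F}, (exists i, (a i)`_0 != 0) /\
    \sum_i (map_poly (const_emb K) (a i)).[x] * y i = 0.
Proof.
move=> x0; have [M hM] := poly_relation x; exists M => y.
have [a [[i ai] aE]] := hM y.
have [n hn] : exists n, forall i, (size (a i) <= n)%N.
  by exists (\max_i size (a i)) => j; exact: leq_bigmax.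
elim: n a i ai aE hn => [|n IH] a i ai aE hn.
  by have := hn i; rewrite leqn0 size_poly_eq0 (negPf ai).
have [/existsP[j aj]|/existsPn a0] := boolP [exists j, (a j)`_0 != 0].
  by exists a; split => //; exists j.
have aX j : a j = (a j %/ 'X) * 'X.
  apply/esym/divpK; rewrite -['X]subr0 -polyC0 dvdp_XsubCl rootE horner_coef0.
  by have := a0 j; rewrite negbK.
apply: (IH (fun j => a j %/ 'X) i).
- by apply: contraNneq ai => /= e; rewrite (aX i) e mul0r.
- apply: (mulfI x0); rewrite mulr0; apply: etrans aE.
  rewrite mulr_sumr; apply: eq_bigr => j _.
  by rewrite [in RHS](aX j) rmorphM /= map_polyX hornerMX mulrA [x * _]mulrC.
- move=> j; have [->|nz] := eqVneq (a j %/ 'X) 0; first by rewrite size_poly0.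
  by have := hn j; rewrite {1}(aX j) size_mulX ?ltnS.
Qed.

End LinearRelations.

(** * Existence of a place *)
Section ValuationRing.
Context (F : finFieldType) (K : fieldExtType {fraction {poly F}}).
Implicit Types (x y z : K) (B : set K).

Definition gen_t : K := in_alg K (@tofrac {poly F} 'X).
Local Notation t := gen_t.
Local Notation evalt p := (map_poly (const_emb K) p).[t].

Lemma evalt_in_alg (p : {poly F}) : evalt p = in_alg K (tofrac p).
Proof.
elim/poly_ind: p => [|p c IH]; first by rewrite !rmorph0 horner0.
rewrite !rmorphD !rmorphM /= map_polyX map_polyC hornerD hornerMX hornerC IH.
by [].
Qed.

Lemma gen_t_neq0 : t != 0.
Proof. by rewrite fmorph_eq0 tofrac_eq0 polyX_eq0. Qed.

(** A ring that contains F[t] and in which [t] is not invertible.  A maximal one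
    is a valuation ring by Chevalley's argument. *)
Record t_ring B : Prop := {
  tring_const : forall c, B (const_emb K c);
  tring_t : B t;
  tringB : forall x y, B x -> B y -> B (x - y);
  tringM : forall x y, B x -> B y -> B (x * y);
  tring_tV : ~ B t^-1 }.

Section TRingTheory.
Context (B : set K) (hB : t_ring B).

Lemma tring0 : B 0.
Proof. by rewrite -(rmorph0 (const_emb K)); exact: tring_const. Qed.

Lemma tring1 : B 1.
Proof. by rewrite -(rmorph1 (const_emb K)); exact: tring_const. Qed.

Lemma tringN x : B x -> B (- x).
Proof. by move=> Bx; rewrite -sub0r; apply: tringB => //; exact: tring0. Qed.

Lemma tringD x y : B x -> B y -> B (x + y).
Proof. by move=> Bx By; rewrite -[y]opprK; apply: tringB => //; exact: tringN. Qed.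

Lemma tring_sum (I : Type) (r : seq I) (P : pred I) (G : I -> K) :
  (forall i, P i -> B (G i)) -> B (\sum_(i <- r | P i) G i).
Proof. by move=> hG; elim/big_ind: _ => //; [exact: tring0|exact: tringD]. Qed.

Lemma tringX x n : B x -> B (x ^+ n).
Proof.
move=> Bx; elim: n => [|n IH]; first by rewrite expr0; exact: tring1.
by rewrite exprS; exact: tringM.
Qed.

Lemma tring_horner (p : {poly K}) x : (forall i, B p`_i) -> B x -> B p.[x].
Proof.
move=> Bp Bx; rewrite horner_coef; apply: tring_sum => i _.
by apply: tringM => //; exact: tringX.
Qed.

Lemma tring_evalt p : B (evalt p).
Proof.
apply: tring_horner; last exact: tring_t.
by move=> i; rewrite coef_map; exact: tring_const.
Qed.

End TRingTheory.

Lemma t_ring_poly : t_ring [set x | exists p, x = evalt p].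
Proof.
split.
- by move=> c; exists c%:P; rewrite map_polyC hornerC.
- by exists 'X; rewrite map_polyX hornerX.
- by move=> _ _ [p ->] [q ->]; exists (p - q); rewrite rmorphB hornerD hornerN.
- by move=> _ _ [p ->] [q ->]; exists (p * q); rewrite rmorphM hornerM.
- move=> [p tp]; have : evalt ('X * p) = evalt 1.
    rewrite rmorphM /= map_polyX hornerM hornerX -tp divff ?gen_t_neq0 //.
    by rewrite rmorph1 hornerC.
  rewrite !evalt_in_alg => /fmorph_inj/eqP; rewrite tofrac_eq => /eqP/(congr1 (horner^~ 0)).
  by rewrite hornerM hornerX mul0r hornerC => /esym/eqP; rewrite oner_eq0.
Qed.

(** The empty set is admitted in the application of Zorn's lemma only because
    the union of the empty chain is empty. *)
Lemma exists_max_t_ring : exists2 B, t_ring B &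
  forall B', t_ring B' -> B `<=` B' -> B' `<=` B.
Proof.
have [C CP Ctot|B [PB Bmax]] := @Zorn_bigcup K (fun B => B = set0 \/ t_ring B).
  have [[X CX tX]|nX] := pselect (exists2 X, C X & t_ring X); last first.
    left; rewrite bigcup0 // => X CX; case: (CP X CX) => // tX.
    by case: nX; exists X.
  right.
  have two x y : (\bigcup_(X in C) X) x -> (\bigcup_(X in C) X) y ->
      exists Y, [/\ C Y, t_ring Y, Y x & Y y].
    move=> [Y CY Yx] [Z CZ Zy].
    have tr W w : C W -> W w -> t_ring W.
      by move=> CW Ww; case: (CP W CW) => // W0; rewrite W0 in Ww.
    have [YZ|ZY] := Ctot Y Z CY CZ.
      by exists Z; split => //; [exact: tr Zy|exact: YZ].
    by exists Y; split => //; [exact: tr Yx|exact: ZY].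
  split.
  - by move=> c; exists X => //; exact: tring_const.
  - by exists X => //; exact: tring_t.
  - move=> x y hx hy; have [Y [CY tY Yx Yy]] := two x y hx hy.
    by exists Y => //; exact: tringB.
  - move=> x y hx hy; have [Y [CY tY Yx Yy]] := two x y hx hy.
    by exists Y => //; exact: tringM.
  - by move=> h; have [Y [CY tY Yx _]] := two _ _ h h; exact: (tring_tV tY).
have tB : t_ring B.
  case: PB => // B0; exfalso; apply: (Bmax _ _ (or_intror t_ring_poly)).
  rewrite B0; split => // /(_ 1) h; apply: h.
  by exists 1; rewrite rmorph1 hornerC.
exists B => // B' tB' BB'; apply: contrapT => nB'B.
by apply: (Bmax B' _ (or_intror tB')); split.
Qed.

(** Chevalley's argument: were neither [x] nor [x^-1] in [B], both would
    satisfy an equation with constant term 1 and all other terms divisible by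
    [t]; combining the two lowers the degree of the longer one. *)
Lemma no_two_relations B (hB : t_ring B) x (p q : {poly K}) : x != 0 ->
  (forall i, B (p`_i / t)) -> (forall i, B (q`_i / t)) ->
  p.[x] = 1 -> q.[x^-1] = 1 -> False.
Proof.
have [n] := ubnP (size p + size q); elim: n x p q => // n IH x p q.
move=> hn x0 hp hq px qx; wlog pq : x p q hn x0 hp hq px qx / (size q <= size p)%N => [wl|].
  have [qp|/ltnW pq] := leqP (size q) (size p); first exact: (wl x p q).
  by apply: (wl x^-1 q p) => //; rewrite ?invr_eq0 ?invrK // addnC.
have p0 : (0 < size p)%N.
  by rewrite lt0n size_poly_eq0; apply/eqP => p0; move: px; rewrite p0 horner0 => /esym/eqP; rewrite oner_eq0.
pose m := (size p).-1; have sp : size p = m.+1 by rewrite /m prednK.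
have Bt y : B (y / t) -> B y.
  by move=> h; rewrite -[y](divfK gen_t_neq0); apply: tringM => //; exact: tring_t.
have [m0|m_gt0] := posnP m.
  have p0C : p = (p`_0)%:P by apply: size1_polyC; rewrite sp m0.

  have := hp 0; move: px; rewrite p0C hornerC coefC eqxx => ->.
  by rewrite mul1r; exact: tring_tV.
pose p' := \poly_(i < m) ((1 - q`_0) * p`_i + p`_m * q`_(m - i) + q`_0 *+ (i == 0%N)).
apply: (IH x p' q _ x0 _ hq _ qx).
- by rewrite -ltnS (leq_trans _ hn) // ltnS ltn_add2r sp ltnS size_poly.
- move=> i; rewrite coef_poly; case: ifP => _; last by rewrite mul0r; exact: tring0.
  rewrite mulrDl mulrDl; apply: tringD => //; last first.
    by case: eqP => _; rewrite ?mulr1n ?mulr0n ?mul0r //; exact: tring0.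
  apply: tringD => //.
    by rewrite -mulrA; apply: tringM => //; apply: tringB => //; [exact: tring1|exact: Bt].
  by rewrite -mulrA; apply: tringM => //; exact: Bt.
rewrite horner_poly.
under eq_bigr do rewrite mulrDl mulrDl -!mulrA.
rewrite !big_split /= -!mulr_sumr.
have -> : \sum_(i < m) q`_(m - i) * x ^+ i = (1 - q`_0) * x ^+ m.
  have : \sum_(i < m.+1) q`_i * (x ^-1) ^+ i = 1.
    by rewrite -qx; apply/esym/horner_coef_wide; rewrite -sp.
  rewrite big_ord_recl expr0 mulr1 => /(canRL (addKr _)); rewrite addrC => <-.
  rewrite mulr_suml (reindex_inj rev_ord_inj) /=; apply: eq_bigr => i _.
  rewrite /bump leq0n add1n subKn // -mulrA; congr (_ * _).
  by rewrite -[in X in _ = _ * X](subnK (ltn_ord i)) exprD exprVn mulrCA mulVf ?mulr1 ?expf_neq0.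
have -> : \sum_(i < m) q`_0 *+ (i == 0%N :> nat) * x ^+ i = q`_0.
  rewrite -(prednK m_gt0) big_ord_recl eqxx mulr1 big1 ?addr0 // => i _.
  by rewrite lift0 /= mulr0n mul0r.
move: px; rewrite horner_coef sp big_ord_recr /= => /(canRL (addrK _)) ->.
ring.
Qed.

End ValuationRing.

Section DiscreteValuation.
Context (F : finFieldType) (K : fieldExtType {fraction {poly F}}).
Implicit Types (x y z : K).
Local Notation t := (gen_t K).
Local Notation evalt p := (map_poly (const_emb K) p).[t].
Context (B : set K) (hB : t_ring B).
Hypothesis Bmax : forall B', t_ring B' -> B `<=` B' -> B' `<=` B.

(** By maximality the ring generated by [B] and [x] contains the inverse of [t];
    the relation is this membership multiplied by [t]. *)
Lemma adjoin_relation x : ~ B x ->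
  exists2 p : {poly K}, (forall i, B (p`_i / t)) & p.[x] = 1.
Proof.
move=> nBx; apply: contrapT => nrel; apply: nBx.
pose B' : set K := [set z | exists2 p : {poly K}, (forall i, B p`_i) & z = p.[x]].
apply: (Bmax (B' := B')); last first.
- exists 'X; last by rewrite hornerX.
  by move=> i; rewrite coefX; case: eqP => _; [exact: tring1|exact: tring0].
- move=> z Bz; exists z%:P; last by rewrite hornerC.
  by move=> i; rewrite coefC; case: eqP => _ //; exact: tring0.
have BC z : B z -> B' z.
  move=> Bz; exists z%:P; last by rewrite hornerC.
  by move=> i; rewrite coefC; case: eqP => _ //; exact: tring0.
split.
- by move=> c; apply: BC; exact: tring_const.
- by apply: BC; exact: tring_t.
- move=> _ _ [p hp ->] [q hq ->]; exists (p - q); last by rewrite hornerD hornerN.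
  by move=> i; rewrite coefB; exact: tringB.
- move=> _ _ [p hp ->] [q hq ->]; exists (p * q); last by rewrite hornerM.
  by move=> i; rewrite coefM; apply: tring_sum => // j _; exact: tringM.
- move=> [p hp tp]; apply: nrel; exists (t *: p).
    by move=> i; rewrite coefZ mulrAC divff ?gen_t_neq0 // mul1r.
  by rewrite hornerZ -tp divff ?gen_t_neq0.
Qed.

Lemma tring_total x : B x \/ B x^-1.
Proof.
have [->|x0] := eqVneq x 0; first by left; exact: tring0.
apply: contrapT => /not_orP[/adjoin_relation[p hp px] /adjoin_relation[q hq qx]].
exact: (no_two_relations hB x0 hp hq px qx).
Qed.

(** The maximal ideal of [B]: an element whose inverse is not in [B] lies in [B],
    because [B] is a valuation ring. *)
Definition nonunit x : Prop := x = 0 \/ ~ B x^-1.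

Lemma nonunitW x : nonunit x -> B x.
Proof. by case=> [->|nB]; [exact: tring0|case: (tring_total x)]. Qed.

Lemma nonunitM b x : B b -> nonunit x -> nonunit (b * x).
Proof.
move=> Bb [->|nB]; first by left; rewrite mulr0.
have [->|b0] := eqVneq b 0; first by left; rewrite mul0r.
by right => h; apply: nB; rewrite -[x^-1](mulKf b0) mulrCA -invfM; apply: tringM.
Qed.

Lemma nonunitD x y : nonunit x -> nonunit y -> nonunit (x + y).
Proof.
wlog : x y / B (x / y) => [wl|Bxy] nx ny.
  case: (tring_total (x / y)) => h; first exact: wl.
  by rewrite addrC; apply: wl => //; rewrite -invf_div.
have [y0|y0] := eqVneq y 0; first by rewrite y0 addr0.
have -> : x + y = (x / y + 1) * y by rewrite mulrDl divfK // mul1r.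
by apply: nonunitM => //; apply: tringD => //; exact: tring1.
Qed.

Lemma nonunitN x : nonunit x -> nonunit (- x).
Proof.
rewrite -mulN1r; apply: nonunitM; apply: tringN => //; exact: tring1.
Qed.

Lemma nonunit_sum (I : Type) (r : seq I) (P : pred I) (G : I -> K) :
  (forall i, P i -> nonunit (G i)) -> nonunit (\sum_(i <- r | P i) G i).
Proof. by move=> hG; elim/big_ind: _ => //; [left|exact: nonunitD]. Qed.

Lemma nonunit1 : ~ nonunit 1.
Proof. by case=> [/eqP|]; [rewrite oner_eq0|rewrite invr1; apply; exact: tring1]. Qed.

Lemma nonunit_t : nonunit t.
Proof. by right; exact: tring_tV. Qed.

Lemma nonunit_const c : nonunit (const_emb K c) -> c = 0.
Proof.
move=> nc; apply/eqP; apply: contrapT => /negP c0; apply: nonunit1.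
rewrite -[1](mulVf (_ : const_emb K c != 0)) ?fmorph_eq0 //.
by apply: nonunitM => //; rewrite -fmorphV; exact: tring_const.
Qed.

Lemma evalt_nonunit (p : {poly F}) : nonunit (evalt p - const_emb K p`_0).
Proof.
elim/poly_ind: p => [|p c _]; first by left; rewrite coef0 !rmorph0 horner0 subrr.
rewrite coefD coefMX coefC eqxx add0r rmorphD rmorphM /= map_polyX map_polyC.
rewrite hornerD hornerMX hornerC addrK; apply: nonunitM; last exact: nonunit_t.
exact: tring_evalt.
Qed.

(** Strictly increasing chains of values below the value of [t] are bounded,
    because elements of distinct values in that range are independent over
    the polynomials in [t]. *)
Lemma value_chain_bound : exists M, forall y : 'I_M.+1 -> K,
  (forall i, B (y i)) -> (forall i, y i != 0) -> (forall i, nonunit (t / y i)) ->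
  ~ forall i j : 'I_M.+1, (i < j)%N -> nonunit (y j / y i).
Proof.
have [M hM] := poly_relation_at0 (gen_t_neq0 K); exists M => y By y0 ty hlt.
have [a [[i1 ai1] aE]] := hM y.
case: (@arg_minnP _ i1 (fun i => (a i)`_0 != 0) (fun i => i) ai1) => i ai imin.
apply/negP: ai; rewrite negbK; apply/eqP/nonunit_const.
have : \sum_j evalt (a j) * (y j / y i) = 0.
  by under eq_bigr do rewrite mulrA; rewrite -mulr_suml aE mul0r.
rewrite (bigD1 i) //= divff // mulr1 => e.
have -> : const_emb K (a i)`_0 =
    - (evalt (a i) - const_emb K (a i)`_0 + \sum_(j | j != i) evalt (a j) * (y j / y i)).
  by rewrite addrAC e sub0r opprK.
apply/nonunitN/nonunitD; first exact: evalt_nonunit.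
apply: nonunit_sum => j ji.
have [ij|] := ltnP i j; first by apply: nonunitM; [exact: tring_evalt|exact: hlt].
rewrite leq_eqVlt (negPf ji : (j : nat) == i = false) /= => lji.
have aj0 : (a j)`_0 = 0.
  by apply/eqP; apply: contraTT lji => /imin; rewrite -leqNgt.
rewrite mulrCA; apply: nonunitM => //.
have [b ->] : exists b, evalt (a j) = evalt b * t.
  elim/poly_ind: (a j) aj0 => [|p c _]; first by exists 0; rewrite !rmorph0 horner0 mul0r.
  rewrite coefD coefMX coefC eqxx add0r => ->; exists p.
  by rewrite addr0 rmorphM /= map_polyX hornerMX.
by rewrite -mulrA; apply: nonunitM; [exact: tring_evalt|exact: ty].
Qed.

Lemma nonunit_iter (y : nat -> K) : (forall k, y k != 0) ->
  (forall k, nonunit (y k.+1 / y k)) ->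
  forall i j, (i < j)%N -> nonunit (y j / y i).
Proof.
move=> y0 hy i j /subnK <-; elim: (j - i.+1)%N => [|k IH]; first exact: hy.
rewrite addSn -[y (k + i.+1).+1](divfK (y0 (k + i.+1)%N)) -!mulrA mulrA.
by apply: nonunitM; [exact: nonunitW (hy _)|exact: IH].
Qed.

(** Without an element of smallest positive value one could descend from [t]
    indefinitely, against the bound on chains. *)
Lemma exists_uniformizer : exists2 p, p != 0 &
  nonunit p /\ forall y, nonunit y -> B (y / p).
Proof.
have [M hM] := value_chain_bound.
apply: contrapT => nex.
have /choice[g hg] (p : K) : exists y, p != 0 -> nonunit p ->
    [/\ nonunit y, y != 0 & nonunit (p / y)].
  have [np|np] := pselect (nonunit p); last by exists 0.
  have [p0|p0] := eqVneq p 0; first by exists 0; rewrite p0.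
  apply: contrapT => h; apply: nex; exists p => //; split => // y ny.
  apply: contrapT => nB; apply: h; exists y => _ _; split => //.
    by apply/eqP => y0; apply: nB; rewrite y0 mul0r; exact: tring0.
  by right; rewrite invf_div.
pose y k := iter k g t.
have hy k : y k != 0 /\ nonunit (y k).
  elim: k => [|k [IH1 IH2]]; first by split; [exact: gen_t_neq0|exact: nonunit_t].
  by have [] := hg _ IH1 IH2.
have ystep k : nonunit (y k / y k.+1) by have [] := hg (y k) (hy k).1 (hy k).2.
have ylt i j : (i < j)%N -> nonunit (y i / y j).
  move=> /subnK <-; elim: (j - i.+1)%N => [|k IH]; first exact: ystep.
  rewrite addSn -[y i](divfK (hy (k + i.+1)%N).1) -!mulrA mulrA.
  by apply: nonunitM; [exact: nonunitW IH|exact: ystep].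
apply: (hM (fun i : 'I_M.+1 => y (M.+1 - i)%N)).
- by move=> i; apply: nonunitW; case: (hy (M.+1 - i)%N).
- by move=> i; case: (hy (M.+1 - i)%N).
- by move=> i; apply: (ylt 0); rewrite subn_gt0.
- by move=> i j ij; apply: ylt; have := ltn_ord j; lia.
Qed.

Context (p : K) (p0 : p != 0) (np : nonunit p) (pmin : forall y, nonunit y -> B (y / p)).

Lemma power_below_t : exists e, B (p ^+ e / t).
Proof.
have [M hM] := value_chain_bound.
apply: contrapT => nex; apply: (hM (fun i => p ^+ i)).
- by move=> i; apply: tringX => //; exact: nonunitW.
- by move=> i; rewrite expf_neq0.
- by move=> i; right; rewrite invf_div => h; apply: nex; exists i.
- move=> i j ij; apply: (nonunit_iter (y := fun k => p ^+ k)) => // k.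
    by rewrite expf_neq0.
  by rewrite exprS mulfK // expf_neq0.
Qed.

(** A nonzero polynomial in [t] has the value of the power of [t] that it is
    exactly divisible by. *)
Lemma t_power_below_evalt q : q != 0 -> exists k, B (t ^+ k / evalt q).
Proof.
have [n] := ubnP (size q); elim: n q => // n IH q sq q0.
have [c0|c0] := eqVneq q`_0 0.
  have /factor_theorem[r] : root q 0 by rewrite rootE horner_coef0 c0.
  rewrite polyC0 subr0 => qE.
  have r0 : r != 0 by apply: contraNneq q0 => r0; rewrite qE r0 mul0r.
  have [|k hk] := IH r _ r0; first by move: sq; rewrite qE size_mulX.
  exists k.+1; rewrite qE rmorphM /= map_polyX hornerMX exprSr.
  by rewrite invfM mulrACA [t / t]divff ?gen_t_neq0 // mulr1.
exists 0%N; rewrite expr0 mul1r; apply: contrapT => nB.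
have /nonunit_const/eqP : nonunit (const_emb K q`_0).
  have -> : const_emb K q`_0 = evalt q - (evalt q - const_emb K q`_0).
    by rewrite subKr.
  by apply: nonunitD; [right|apply: nonunitN; exact: evalt_nonunit].
by rewrite (negPf c0).
Qed.

(** In an algebraic equation of [x] over F[t], the nonzero coefficient of lowest
    index is divisible by [x] in [B]; so the powers of [x] cannot be
    infinitely small with respect to [t]. *)
Lemma t_power_below x : B x -> x != 0 -> exists k, B (t ^+ k / x).
Proof.
move=> Bx x0; have [M hM] := poly_relation t.
have [a [[i1 ai1] aE]] := hM (fun i => x ^+ i).
case: (@arg_minnP _ i1 (fun i => a i != 0) (fun i => i) ai1) => i ai imin.
have [k hk] := t_power_below_evalt ai; exists k.
have -> : t ^+ k / x = (t ^+ k / evalt (a i)) * (evalt (a i) / x).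
  by rewrite mulrA divfK // evalt_in_alg !fmorph_eq0 tofrac_eq0.
apply: tringM => //.
have : \sum_(j < M.+1) evalt (a j) * (x ^+ j / x ^+ i) = 0.
  by under eq_bigr do rewrite mulrA; rewrite -mulr_suml aE mul0r.
rewrite (bigD1 i) //= divff ?expf_neq0 // mulr1 => /eqP; rewrite addr_eq0 => /eqP ->.
rewrite mulNr; apply: tringN => //; rewrite mulr_suml; apply: tring_sum => // j ji.
have [ij|] := ltnP i j.
  rewrite -mulrA; apply: tringM => //; first exact: tring_evalt.
  rewrite -(subnK ij) -addSnnS exprD mulrK ?unitfE ?expf_neq0 // exprSr mulfK //.
  exact: tringX.
rewrite leq_eqVlt (negPf ji : (j : nat) == i = false) /= => lji.
have -> : a j = 0 by apply/eqP; apply: contraTT lji => /imin; rewrite -leqNgt.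
by rewrite rmorph0 horner0 !mul0r; exact: tring0.
Qed.

(** [x] is a unit of [B] times [p ^ n], so that [n] is the normalized valuation
    of [x]. *)
Definition unit_multiple x (n : int) : Prop := B (x / p ^ n) /\ B (p ^ n / x).

Lemma pexp_neq0 n : p ^ n != 0. Proof. by rewrite expfz_neq0. Qed.

Lemma unit_multiple_exists x : x != 0 -> exists n, unit_multiple x n.
Proof.
wlog Bx : x / B x => [wl x0|x0].
  have [Bx|Bx] := tring_total x; first exact: wl.
  have [|n [h1 h2]] := wl _ Bx; first by rewrite invr_eq0.
  by exists (- n); split; rewrite -invr_expz; [rewrite invrK -[x]invrK|]; rewrite mulrC.
have [e he] := power_below_t; have [k hk] := t_power_below Bx x0.
have ex : exists n, `[< B (p ^+ n / x) >].
  exists (e * k)%N; apply/asboolP; rewrite exprM.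
  rewrite -[_ ^+ k](divfK (expf_neq0 k (gen_t_neq0 K))) -expr_div_n -mulrA.
  by apply: tringM => //; exact: tringX.
case: (ex_minnP ex) => -[|n] /asboolP hn nmin.
  by exists 0; split; rewrite expr0z ?divr1 // -[1](expr0 p).
exists n.+1; split => //.
rewrite -exprnP exprS invfM mulrA mulrAC; apply: pmin; right; rewrite invf_div => h.
by have := nmin n (asboolT h); rewrite ltnn.
Qed.

Lemma unit_multiple_le x m n : x != 0 -> unit_multiple x n -> B (x / p ^ m) <-> m <= n.
Proof.
move=> x0 [h1 h2]; split => [h|].
  rewrite leNgt; apply/negP => nm; apply: nonunit1.
  have -> : 1 = (p ^ n / x) * (x / p ^ m) * p ^ (m - n).
    by rewrite expfzDr // -invr_expz; field; rewrite !pexp_neq0 x0.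
  apply: nonunitM; first exact: tringM.
  have : 0 < m - n by rewrite subr_gt0.
  case: (m - n) => // -[//|k] _; rewrite -exprnP exprS mulrC; apply: nonunitM => //.
  by apply: tringX => //; exact: nonunitW.
rewrite -subr_ge0 => mn; have -> : x / p ^ m = (x / p ^ n) * p ^ (n - m).
  by rewrite expfzDr // -invr_expz mulrA divfK ?pexp_neq0.
apply: tringM => //; case: (n - m) mn => // k _.
by apply: tringX => //; exact: nonunitW.
Qed.

Lemma exists_place_of_uniformizer : exists v : K -> \bar int, place K v.
Proof.
have /choice[w hw] x : exists n, x != 0 -> unit_multiple x n.
  have [x0|x0] := eqVneq x 0; first by exists 0.
  by have [n hn] := unit_multiple_exists x0; exists n.
have wP x m : x != 0 -> B (x / p ^ m) <-> m <= w x.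
  by move=> x0; apply: unit_multiple_le => //; exact: hw.
have w_eq x n : x != 0 -> unit_multiple x n -> w x = n.
  move=> x0 hn; apply/eqP; rewrite eq_le; apply/andP; split.
    by apply/(unit_multiple_le _ x0 hn)/wP.
  by apply/wP => //; apply/(unit_multiple_le _ x0 hn).
exists (fun x => if x == 0 then +oo%E else (w x)%:E); split => /=.
- by move=> x; case: ifP.
- by move=> x; split=> [|->]; [case: eqP|rewrite eqxx].
- move=> x y; rewrite mulf_eq0; have [->|x0] := eqVneq x 0.
    by case: ifP.
  have [->|y0] := eqVneq y 0; first by [].
  rewrite /= -EFinD; congr (_%:E); apply: w_eq; first by rewrite mulf_neq0.
  have [x1 x2] := hw x x0; have [y1 y2] := hw y y0.
  by split; rewrite expfzDr // invfM mulrACA; exact: tringM.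
- move=> x y; have [->|x0] := eqVneq x 0.
    by rewrite add0r ge_min lexx orbT.
  have [->|y0] := eqVneq y 0; first by rewrite addr0 (negPf x0) ge_min lexx.
  have [_|xy0] := eqVneq (x + y) 0; first by rewrite leey.
  rewrite -EFin_min lee_fin; apply/wP => //.
  by rewrite mulrDl; apply: tringD => //; apply/wP => //; rewrite ge_min lexx ?orbT.
- exists p; rewrite (negPf p0); congr (_%:E); apply: w_eq => //.
  by split; rewrite expr1z divff //; exact: tring1.
Qed.

End DiscreteValuation.

Lemma exists_place (F : finFieldType) (K : fieldExtType {fraction {poly F}}) :
  exists v : K -> \bar int, place K v.
Proof.
have [B hB Bmax] := exists_max_t_ring K.
have [p p0 [np pmin]] := exists_uniformizer hB Bmax.
exact: exists_place_of_uniformizer Bmax p p0 np pmin.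
Qed.

(** * Places and weak approximation *)
Section Orders.
Context (F : finFieldType) (K : fieldExtType {fraction {poly F}}).
Implicit Types (v w : place K) (x y z : K) (c : F) (m n : int).

(** The order as an integer; its value at 0 is the default 0, so statements
    about possibly vanishing elements use [vge] instead. *)
Definition ord v x : int := fine (val v x).
Definition vge v n x : bool := (n%:E <= val v x)%E.

Lemma placeP v : normalized_valuation (val v).
Proof. exact: set_mem (valP v). Qed.

Lemma val_ord v x : x != 0 -> val v x = (ord v x)%:E.
Proof.
move=> x0; rewrite /ord; case e : (val v x) => [r||] //=.
  by move/(nval_eqy (placeP v))/eqP: e; rewrite (negPf x0).
by have := nval_gtNy (placeP v) x; rewrite e eqxx.
Qed.

Lemma val_zero v : val v 0 = +oo%E.
Proof. by apply/(nval_eqy (placeP v)). Qed.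

Lemma vge_ord v n x : x != 0 -> vge v n x = (n <= ord v x).
Proof. by move=> x0; rewrite /vge val_ord // lee_fin. Qed.

Lemma vge0 v n : vge v n 0.
Proof. by rewrite /vge val_zero leey. Qed.

Lemma ordM v x y : x != 0 -> y != 0 -> ord v (x * y) = ord v x + ord v y.
Proof. by move=> x0 y0; rewrite {1}/ord (nvalM (placeP v)) !val_ord. Qed.

Lemma ord_one v : ord v 1 = 0.
Proof.
by have := ordM v (oner_neq0 K) (oner_neq0 K); rewrite mulr1 => /eqP; rewrite -subr_eq subrr eq_sym => /eqP.
Qed.

Lemma ordV v x : x != 0 -> ord v x^-1 = - ord v x.
Proof.
move=> x0; have x'0 : x^-1 != 0 by rewrite invr_eq0.
by apply/eqP; rewrite -subr_eq0 opprK -ordM ?mulVf ?ord_one.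
Qed.

Lemma ordX v x k : x != 0 -> ord v (x ^+ k) = ord v x *+ k.
Proof.
move=> x0; elim: k => [|k IH]; first by rewrite expr0 ord_one.
by rewrite exprS ordM ?expf_neq0 // IH mulrS.
Qed.

Lemma ordXz v x n : x != 0 -> ord v (x ^ n) = ord v x * n.
Proof.
move=> x0; case: n => k; first by rewrite -exprnP ordX // -mulr_natr natz.
by rewrite NegzE -exprnN ordV ?expf_neq0 // ordX // -mulr_natr natz mulrN.
Qed.

(** [c] is a root of unity because [F] is finite. *)
Lemma ord_const v c : c != 0 -> ord v (const_emb K c) = 0.
Proof.
move=> c0; have q1 := finNzRing_gt1 F.
have := ordX v #|F| (_ : const_emb K c != 0); rewrite fmorph_eq0 => /(_ c0).
rewrite -rmorphXn expf_card -mulr_natr natz => h.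
have /eqP : ord v (const_emb K c) * (#|F|%:Z - 1) = 0 by rewrite mulrBr mulr1 -h subrr.
rewrite mulf_eq0 => /orP[/eqP//|]; rewrite subr_eq0 => /eqP [] e.
by move: q1; rewrite e.
Qed.

Lemma vgeD v n x y : vge v n x -> vge v n y -> vge v n (x + y).
Proof.
move=> hx hy; apply: le_trans (nvalD (placeP v) x y).
by rewrite le_min; apply/andP.
Qed.

Lemma vge_sum v n (I : Type) (r : seq I) (P : pred I) (G : I -> K) :
  (forall i, P i -> vge v n (G i)) -> vge v n (\sum_(i <- r | P i) G i).
Proof. by move=> hG; elim/big_ind: _ => //; [exact: vge0|exact: vgeD]. Qed.

Lemma vgeM v m n x y : vge v m x -> vge v n y -> vge v (m + n) (x * y).
Proof.
have [->|x0] := eqVneq x 0; first by rewrite mul0r => _ _; exact: vge0.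
have [->|y0] := eqVneq y 0; first by rewrite mulr0 => _ _; exact: vge0.
by move=> hx hy; rewrite vge_ord ?mulf_neq0 // ordM // lerD // -vge_ord.
Qed.

Lemma vgeW v m n x : m <= n -> vge v n x -> vge v m x.
Proof. by move=> mn; apply: le_trans; rewrite lee_fin. Qed.

Lemma vge_const v c : vge v 0 (const_emb K c).
Proof.
have [->|c0] := eqVneq c 0; first by rewrite rmorph0 vge0.
by rewrite vge_ord ?fmorph_eq0 // ord_const.
Qed.

Lemma vgeZ v n c x : vge v n x -> vge v n (const_emb K c * x).
Proof. by move=> hx; rewrite -[n]add0r; apply: vgeM => //; exact: vge_const. Qed.

Lemma vgeN v n x : vge v n x -> vge v n (- x).
Proof. by rewrite -mulN1r -[-1](rmorphN1 (const_emb K)); exact: vgeZ. Qed.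

Lemma vgeB v n x y : vge v n x -> vge v n y -> vge v n (x - y).
Proof. by move=> hx hy; apply: vgeD => //; exact: vgeN. Qed.

Lemma vgeX v x k : vge v 0 x -> vge v 0 (x ^+ k).
Proof.
move=> hx; elim: k => [|k IH]; first by rewrite expr0 vge_ord ?oner_neq0 // ord_one.
by rewrite exprS -[0 in X in vge _ X](addr0 0); exact: vgeM.
Qed.

Lemma vgeMl v m n x y : y != 0 -> ord v y = m -> vge v (n + m) (x * y) = vge v n x.
Proof.
move=> y0 vy; have [->|x0] := eqVneq x 0; first by rewrite mul0r !vge0.
by rewrite !vge_ord ?mulf_neq0 // ordM // vy lerD2r.
Qed.

Lemma ordD_lt v x y : x != 0 -> vge v (ord v x + 1) y ->
  x + y != 0 /\ ord v (x + y) = ord v x.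
Proof.
move=> x0 hy.
have nx : ~~ vge v (ord v x + 1) x by rewrite vge_ord // -ltNge ltrDl.
have xy0 : x + y != 0.
  apply: contra nx => /eqP xy0; have := vgeN hy.
  by rewrite -[- y]add0r -xy0 addrK.
split=> //; apply/eqP; rewrite eq_le; apply/andP; split; last first.
  rewrite -vge_ord //; apply: vgeD; first by rewrite vge_ord.
  by apply: vgeW hy; rewrite lerDl.
rewrite leNgt -lezD1 -vge_ord //; apply: contra nx => h.
by have := vgeB h hy; rewrite addrK.
Qed.

Lemma exists_ord1 v : exists2 x, x != 0 & ord v x = 1.
Proof.
have [x vx] := nval_uniformizer (placeP v).
have x0 : x != 0 by apply/eqP => x0; move: vx; rewrite x0 val_zero.
by exists x => //; rewrite /ord vx.
Qed.

(** If the valuation ring of [v] were contained in that of [w], units would go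
    to units and [ord w] would be a multiple of [ord v]; normalization then
    makes the two places equal. *)
Lemma separate_places v w : v <> w -> exists2 x, x != 0 & 0 <= ord v x /\ ord w x < 0.
Proof.
move=> nvw; apply: contrapT => h.
have sub x : x != 0 -> 0 <= ord v x -> 0 <= ord w x.
  by move=> x0 vx; rewrite leNgt; apply/negP => wx; apply: h; exists x.
have sub0 x : x != 0 -> ord v x = 0 -> ord w x = 0.
  move=> x0 vx; apply/eqP; rewrite eq_le sub ?vx // andbT -oppr_ge0 -ordV //.
  by rewrite sub ?invr_eq0 // ordV // vx.
have [p p0 vp] := exists_ord1 v.
have prop x : x != 0 -> ord w x = ord v x * ord w p.
  move=> x0; have x'0 : x / p ^ ord v x != 0 by rewrite mulf_neq0 ?invr_eq0 ?expfz_neq0.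
  have := sub0 _ x'0; rewrite !ordM ?invr_eq0 ?expfz_neq0 // !ordV ?expfz_neq0 // !ordXz //.
  by rewrite vp mul1r subrr => /(_ erefl)/eqP; rewrite subr_eq0 mulrC => /eqP.
have [p' p'0 wp'] := exists_ord1 w.
have wp0 : 0 <= ord w p by apply: sub; rewrite ?vp.
have wp1 : ord w p = 1.
  have aux (a b : int) : 0 <= b -> 1 = a * b -> b = 1.
    move=> b0 ab; have [bz|b1] : b = 0 \/ 1 <= b by lia.
      by move: ab; rewrite bz mulr0.
    have a1 : 1 <= a by nia.
    nia.
  by apply: (aux (ord v p')) => //; rewrite -prop.
apply: nvw; apply/val_inj/funext => x.
have [->|x0] := eqVneq x 0; first by rewrite !val_zero.
by rewrite !val_ord // prop // wp1 mulr1.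
Qed.

Lemma separate_places2 v w : v <> w -> exists2 x, x != 0 & 0 < ord v x /\ ord w x < 0.
Proof.
move=> vw; have [x x0 [vx wx]] := separate_places vw.
have [|y y0 [wy vy]] := @separate_places w v; first by move=> /esym.
exists (x / y); first by rewrite mulf_neq0 ?invr_eq0.
by rewrite !ordM ?invr_eq0 // !ordV //; lia.
Qed.

(** Induction on the list: when the element [y] found so far has no pole at the
    new place, a high power of an element separating [v] from it is added; the
    exponent is chosen so large that no cancellation of orders can occur at the
    other places. *)
Lemma weak_approximation v (s : seq (place K)) : v \notin s ->
  exists2 x, x != 0 & 0 < ord v x /\ forall w, w \in s -> ord w x < 0.
Proof.
elim: s => [_|w s IH].
  by have [x x0 vx] := exists_ord1 v; exists x => //; split; [rewrite vx|].
rewrite inE negb_or => /andP[/eqP vw /IH[y y0 [vy sy]]].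
have [wy|wy] := ltP (ord w y) 0.
  by exists y => //; split=> // u; rewrite inE => /predU1P[->|/sy].
have [z z0 [vz wz]] := separate_places2 vw.
pose k := (\max_(u <- s) `|ord u y|%N).+1.
have yk u : u \in s -> - k%:Z < ord u y.
  move=> us; have : (`|ord u y| < k)%N by rewrite ltnS (big_rem u) //= leq_maxl.
  by lia.
have zk u : ord u (z ^+ k) = ord u z * k%:Z by rewrite ordX // -mulr_natr natz.
have zk0 : z ^+ k != 0 by rewrite expf_neq0.
have lo u : u \in s -> y + z ^+ k != 0 /\ ord u (y + z ^+ k) < 0.
  move=> us; have := sy u us; have := yk u us => h1 h2.
  have [uz|uz] := ltP (ord u z) 0.
    rewrite addrC; have [||-> ->] := @ordD_lt u (z ^+ k) y => //.
      by rewrite vge_ord // zk; nia.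
    by rewrite zk; nia.
  have [||-> ->] := @ordD_lt u y (z ^+ k) => //.
  by rewrite vge_ord // zk; nia.
have [n0 hw] : y + z ^+ k != 0 /\ ord w (y + z ^+ k) < 0.
  rewrite addrC; have [||-> ->] := @ordD_lt w (z ^+ k) y => //.
    by rewrite vge_ord // zk; nia.
  by rewrite zk; nia.
exists (y + z ^+ k) => //; split; last first.
  by move=> u; rewrite inE => /predU1P[->//|us]; case: (lo u us).
rewrite gtz0_ge1 -vge_ord //; apply: vgeD; rewrite vge_ord //.
  by rewrite zk; nia.
Qed.

End Orders.

(** * Finiteness of zeros and of residue degrees *)
Section Finiteness.
Context (F : finFieldType) (K : fieldExtType {fraction {poly F}}).
Implicit Types (v w : place K) (x y z : K) (c : F) (m : int) (n : nat).

Lemma exists_separating v (s : seq (place K)) : v \notin s ->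
  exists x, [/\ x != 0, ord v x = 0 & forall w, w \in s -> 0 < ord w x].
Proof.
move=> vs; have [y y0 [vy sy]] := weak_approximation vs.
have ord1w w : ord w (1 : K) = 0 by exact: ord_one.
have [|n0 v1] := @ordD_lt _ _ v 1 y (oner_neq0 _).
  by rewrite ord1w add0r vge_ord // -gtz0_ge1.
exists (1 + y)^-1; split; rewrite ?invr_eq0 // ?ordV // ?v1 ?ord1w //.
move=> w ws; rewrite ordV // oppr_gt0 addrC.
have [||_ ->] := @ordD_lt _ _ w y 1 => //; last exact: sy.
by rewrite vge_ord ?oner_neq0 // ord1w; have := sy w ws; lia.
Qed.

Lemma poly_eval_ge v x (p : {poly F}) : vge v 1 x ->
  vge v 1 ((map_poly (const_emb K) p).[x] - const_emb K p`_0) /\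
  vge v 0 (map_poly (const_emb K) p).[x].
Proof.
move=> vx; have x_ge0 : vge v 0 x by apply: vgeW vx.
have ev q : vge v 0 (map_poly (const_emb K) q).[x].
  elim/poly_ind: q => [|q c IH]; first by rewrite rmorph0 horner0 vge0.
  rewrite rmorphD rmorphM /= map_polyX map_polyC hornerD hornerMX hornerC.
  by apply: vgeD; [rewrite -[0 in X in vge _ X](addr0 0); exact: vgeM|exact: vge_const].
split => //; elim/poly_ind: p => [|p c _]; first by rewrite coef0 !rmorph0 horner0 subrr vge0.
rewrite coefD coefMX coefC eqxx add0r rmorphD rmorphM /= map_polyX map_polyC.
rewrite hornerD hornerMX hornerC addrK -[1 in X in vge _ X](add0r 1).
exact: vgeM.
Qed.

(** Elements [y i] that are units at the [i]-th zero of [x] and vanish at the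
    others are linearly independent over F[x]: reduce a relation modulo the
    place whose coefficient does not vanish at 0. *)
Lemma finite_zeros x : x != 0 -> finite_set [set v : place K | 0 < ord v x].
Proof.
move=> x0; apply: contrapT => inf.
have [M hM] := poly_relation_at0 x0.
have [B Bsub hB] : exists2 B : {fset place K},
    [set` B] `<=` [set v | 0 < ord v x] & (M.+1 <= #|` B|)%N.
  by have [B B1 B2] := infinite_set_fset M.+1 inf; exists B.
have /choice[y hy] v : exists x : K, [/\ x != 0, ord v x = 0 &
    forall w, w \in [seq w <- B | w != v] -> 0 < ord w x].
  by apply: exists_separating; rewrite mem_filter eqxx.
have [v0 v0B] : exists v, v \in B.
  by apply/fset0Pn; rewrite -cardfs_gt0; exact: leq_trans hB.
pose V (i : 'I_M.+1) := nth v0 B i.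
have lt_size (i : 'I_M.+1) : (i < size B)%N by exact: leq_trans (ltn_ord i) hB.
have VB i : V i \in B by apply: mem_nth; exact: lt_size.
have [a [[i ai] aE]] := hM (fun i => y (V i)).
have Vij j : j != i -> V i != V j.
  by move=> ji; apply: contra ji; rewrite /V nth_uniq ?lt_size ?fset_uniq // eq_sym => /eqP e; apply/eqP/val_inj.
have vx : vge (V i) 1 x by rewrite vge_ord //; rewrite -gtz0_ge1; exact: (Bsub _ (VB i)).
suff : vge (V i) 1 (const_emb K (a i)`_0 * y (V i)).
  have [yi0 yi _] := hy (V i).
  by rewrite vge_ord ?mulf_neq0 ?fmorph_eq0 // ordM ?fmorph_eq0 // ord_const // yi.
move: aE; rewrite (bigD1 i) //= => /eqP; rewrite addr_eq0 => /eqP aE.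
have [h1 h2] := poly_eval_ge (a i) vx; have [yi0 yi _] := hy (V i).
rewrite -[const_emb _ _](subKr (map_poly (const_emb K) (a i)).[x]) mulrBl aE.
apply: vgeB; last first.
  by rewrite -[1 in X in vge _ X](addr0 1); apply: vgeM => //; rewrite vge_ord ?yi.
apply: vgeN; apply: vge_sum => j ji; rewrite -[1 in X in vge _ X](add0r 1).
have [yj0 _ yj] := hy (V j).
apply: vgeM; first by case: (poly_eval_ge (a j) vx).
by rewrite vge_ord //; rewrite -gtz0_ge1; apply: yj; rewrite mem_filter Vij ?VB.
Qed.


(** A family in [V] of maximal size that is independent modulo [W] is a basis of
    the quotient. *)
Lemma quot_dim_exists (V W : set K) (M : nat) :
  (forall x y, W x -> W y -> W (x + y)) -> (forall c x, W x -> W (const_emb K c * x)) ->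
  (forall y : 'I_M.+1 -> K, (forall i, V (y i)) -> exists c : 'rV[F]_M.+1, c != 0 /\
     W (\sum_i const_emb K (c 0 i) * y i)) ->
  exists n, is_quot_dim V W n.
Proof.
move=> WD WZ dep.
pose indep n (b : 'I_n -> K) := (forall i, V (b i)) /\
  forall c : 'rV[F]_n, W (\sum_i const_emb K (c 0 i) * b i) -> c = 0.
have indep_bound n b : indep n b -> (n <= M)%N.
  move=> [Vb ib]; rewrite leqNgt; apply/negP => Mn.
  have [c [c0 Wc]] := dep (fun i => b (widen_ord Mn i)) (fun i => Vb _).
  move/eqP: c0; apply; apply/rowP => i; rewrite mxE.
  pose c' : 'rV[F]_n := \row_j if insub (val j) is Some i then c 0 i else 0.
  suff /ib/rowP/(_ (widen_ord Mn i)) : W (\sum_i const_emb K (c' 0 i) * b i).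
    by rewrite !mxE /= valK.
  rewrite (_ : \sum__ _ = \sum_(i < M.+1) const_emb K (c 0 i) * b (widen_ord Mn i)) //.
  rewrite (bigID (fun j : 'I_n => (j < M.+1)%N)) /= [X in _ + X]big1 ?addr0; last first.
    by move=> j hj; rewrite mxE insubN // rmorph0 mul0r.
  rewrite (big_ord_narrow Mn); apply: eq_bigr => j _.
  by rewrite mxE /= valK.
have ex0 : exists n, `[< exists b, indep n b >].
  exists 0%N; apply/asboolP; exists (fun=> 0); split; first by case.
  by move=> c _; apply/rowP => -[].
have [n /asboolP[b [Vb ib]] nmax] := ex_maxnP ex0 (fun n => fun h => let: ex_intro b hb := asboolW h in indep_bound n b hb).
exists n, b; split => // x Vx.
pose b' (i : 'I_n.+1) := if unlift ord_max i is Some j then b j else x.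
have sumb' (c : 'rV[F]_n.+1) : \sum_i const_emb K (c 0 i) * b' i =
   \sum_(i < n) const_emb K (c 0 (lift ord_max i)) * b i + const_emb K (c 0 ord_max) * x.
  rewrite (bigD1_ord ord_max) //= addrC /b' unlift_none; congr (_ + _).
  by apply: eq_bigr => i _; rewrite liftK.
have [c [c0 Wc]] : exists c : 'rV[F]_n.+1, c != 0 /\ W (\sum_i const_emb K (c 0 i) * b' i).
  apply: contrapT => h.
  suff /asboolT/nmax : exists b, indep n.+1 b by rewrite ltnn.
  exists b'; split; first by rewrite /b' => i; case: unliftP.
  move=> c Wc; apply/eqP; apply: contrapT => /negP c0; apply: h; exists c; by split.
rewrite sumb' in Wc.
have cm0 : c 0 ord_max != 0.
  apply: contra c0 => /eqP cm; apply/eqP/rowP => i; rewrite mxE.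
  move: Wc; rewrite cm rmorph0 mul0r addr0 => Wc.
  have := ib (\row_i c 0 (lift ord_max i)).
  under eq_bigr do rewrite mxE.
  move=> /(_ Wc)/rowP h; case: (unliftP ord_max i) => [j ->|->] //.
  by have := h j; rewrite !mxE.
exists (\row_i (- c 0 (lift ord_max i) / c 0 ord_max)); split.
  have -> : x - \sum_(i < n) const_emb K ((\row_i (- c 0 (lift ord_max i) / c 0 ord_max)) 0 i) * b i
     = const_emb K (c 0 ord_max)^-1 * (\sum_(i < n) const_emb K (c 0 (lift ord_max i)) * b i +
     const_emb K (c 0 ord_max) * x).
    rewrite mulrDr mulrA -rmorphM mulVf // rmorph1 mul1r addrC; congr (_ + _).
    rewrite mulr_sumr -sumrN; apply: eq_bigr => i _.
    by rewrite mxE mulNr rmorphN mulNr opprK [_ / _]mulrC rmorphM mulrA.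
  exact: WZ.
move=> d Wd; apply/rowP => i.
have e : const_emb K (c 0 ord_max) * (x - \sum_(i < n) const_emb K (d 0 i) * b i) =
   \sum_(i < n) const_emb K (c 0 (lift ord_max i)) * b i + const_emb K (c 0 ord_max) * x
   - \sum_(i < n) const_emb K (c 0 (lift ord_max i) + c 0 ord_max * d 0 i) * b i.
  rewrite mulrBr addrAC -sumrB addrC mulr_sumr -sumrN; congr (_ + _).
  by apply: eq_bigr => j _; rewrite rmorphD rmorphM mulrDl; ring.
have : W (\sum_(i < n) const_emb K (c 0 (lift ord_max i) + c 0 ord_max * d 0 i) * b i).
  have := WD _ _ Wc (WZ (- 1) _ (WZ (c 0 ord_max) _ Wd)).
  by rewrite e rmorphN1 mulN1r opprB addrC subrK.
have := ib (\row_i (c 0 (lift ord_max i) + c 0 ord_max * d 0 i)).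
under eq_bigr do rewrite mxE.
move=> h /h /rowP/(_ i); rewrite !mxE => /eqP; rewrite addrC addr_eq0 => /eqP h'.
by rewrite -h' mulrC mulKf.
Qed.

End Finiteness.

Section ResidueField.
Context (F : finFieldType) (K : fieldExtType {fraction {poly F}}).
Implicit Types (v w : place K) (x y z : K) (m : int) (n : nat).

Lemma val_gt0 v x : (0 < val v x)%E = vge v 1 x.
Proof.
have [->|x0] := eqVneq x 0; first by rewrite val_zero vge0 ltey.
by rewrite vge_ord // val_ord // lte_fin gtz0_ge1.
Qed.

(** A relation over F[p], with [p] a uniformizer, reduces to a relation over F
    between residues. *)
Lemma residue_degreeP v : is_quot_dim
  [set x | (0 <= val v x)%E] [set x | (0 < val v x)%E] (residue_degree v).
Proof.
apply: xgetPex; have [p p0 vp] := exists_ord1 v.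
have [M hM] := poly_relation_at0 p0.
apply: (quot_dim_exists (M := M)) => [x y|c x|y Vy] /=; rewrite ?val_gt0.
- exact: vgeD.
- exact: vgeZ.
have [a [[i ai] aE]] := hM y.
exists (\row_i (a i)`_0); split.
  by apply: contraNneq ai => /rowP/(_ i); rewrite !mxE => ->.
have vp1 : vge v 1 p by rewrite vge_ord // vp.
have -> : \sum_i const_emb K ((\row_i (a i)`_0) 0 i) * y i =
    - \sum_i ((map_poly (const_emb K) (a i)).[p] - const_emb K (a i)`_0) * y i.
  under [in RHS]eq_bigr do rewrite mulrBl.
  by rewrite sumrB aE sub0r opprK; apply: eq_bigr => j _; rewrite mxE.
rewrite /= val_gt0; apply: vgeN; apply: vge_sum => j _; rewrite -[1 in X in vge _ X](addr0 1).
by apply: vgeM; [case: (poly_eval_ge (a j) vp1)|exact: Vy].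
Qed.

(** The reduction map onto the residue field, in coordinates.  Only its fibres
    and its surjectivity matter below. *)
Lemma residue_map v : exists r : K -> 'rV[F]_(residue_degree v),
  (forall x y, vge v 0 x -> vge v 0 y -> r x = r y <-> vge v 1 (x - y)) /\
  (forall c, exists2 x, vge v 0 x & r x = c).
Proof.
have [b [Vb hb]] := residue_degreeP v.
have /choice[r hr] x : exists c : 'rV[F]_(residue_degree v), vge v 0 x ->
    vge v 1 (x - \sum_i const_emb K (c 0 i) * b i) /\
    forall c' : 'rV[F]_(residue_degree v), vge v 1 (x - \sum_i const_emb K (c' 0 i) * b i) -> c = c'.
  have [vx|vx] := boolP (vge v 0 x); last by exists 0.
  by have [c [/=]] := hb x vx; rewrite val_gt0 => h1 h2; exists c => _; split => // c';
    rewrite -val_gt0; exact: h2.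
exists r; split.
  move=> x y vx vy; have [rx rx'] := hr x vx; have [ry ry'] := hr y vy; split.
    move=> rxy; rewrite -rxy in ry; have := vgeB rx ry.
    by rewrite opprB addrA subrK.
  by move=> h; apply: rx'; have := vgeD h ry; rewrite addrA subrK.
move=> c; have vs : vge v 0 (\sum_i const_emb K (c 0 i) * b i).
  by apply: vge_sum => i _; apply: vgeZ; exact: Vb.
exists (\sum_i const_emb K (c 0 i) * b i) => //.
by have [_] := hr _ vs; apply; rewrite subrr vge0.
Qed.

Lemma residue_degree_gt0 v : (0 < residue_degree v)%N.
Proof.
have [r [hr _]] := residue_map v; rewrite lt0n; apply/negP => /eqP d0.
have : vge v 1 (1 - 0 : K).
  apply/(hr 1 0); rewrite ?vge0 // ?vge_ord ?oner_neq0 ?ord_one //.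
  by apply/rowP => -[i hi]; exfalso; move: hi; rewrite d0.
by rewrite subr0 vge_ord ?oner_neq0 // ord_one.
Qed.

End ResidueField.

Lemma card_set_seq (T : choiceType) (V : set T) (r : seq T) :
  (forall x, V x <-> x \in r) -> uniq r ->
  finite_set V /\ #|` fset_set V| = size r.
Proof.
move=> VE ur.
have {VE} -> : V = [set` [fset x in r]%fset].
  by apply/seteqP; split=> x /=; rewrite !inE => /VE.
by rewrite set_fsetK card_fseq undup_id //; split => //; exact: finite_fset.
Qed.

(** Lagrange's theorem: [V] is a union of translates of [W], one for each value
    taken by [rho]. *)
Lemma card_extension (G : zmodType) (T : finType) (V W : set G) (rho : G -> T) :
  V 0 -> (forall x y, V x -> V y -> V (x - y)) -> finite_set W -> W `<=` V ->
  (forall x y, V x -> V y -> rho x = rho y <-> W (x - y)) ->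
  finite_set V /\ #|` fset_set V| =
     (#|[set c | `[< exists2 x, V x & rho x = c >]]%SET| * #|` fset_set W|)%N.
Proof.
move=> V0 VB finW WV hrho.
have /choice[s hs] c : exists x, (exists2 x, V x & rho x = c) -> V x /\ rho x = c.
  have [[x Vx rx]|h] := pselect (exists2 x, V x & rho x = c); first by exists x.
  by exists 0.
set H := [set c | _]%SET.
have HP c : c \in H -> V (s c) /\ rho (s c) = c.
  by rewrite inE => /asboolP /hs.
have HV x : V x -> rho x \in H by move=> Vx; rewrite inE; apply/asboolP; exists x.
clearbody H.
have VD x y : V x -> V y -> V (x + y).
  by move=> Vx Vy; rewrite -[y]opprK; apply: (VB) => //; rewrite -sub0r; exact: VB.
rewrite cardE -(size_allpairs (fun c x => s c + x)).
have WP x : x \in fset_set W -> W x by rewrite in_fset_set // => /set_mem.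
apply: card_set_seq => [x|]; first split.
- move=> Vx; have rH := HV _ Vx; have [h1 h2] := HP _ rH.
  apply/allpairsP; exists (rho x, x - s (rho x)); split; rewrite ?mem_enum //=.
    by rewrite in_fset_set // mem_set //; apply/(hrho _ _ Vx h1); rewrite h2.
  by rewrite addrC subrK.
- move=> /allpairsP[[c z] /= [cH /WP/WV Vz ->]]; apply: VD => //.
  by case: (HP c); rewrite // -mem_enum.
apply: allpairs_uniq; [exact: enum_uniq|exact: fset_uniq|].
move=> _ _ /allpairsP[[c x] /= [cH /WP Wx ->]] /allpairsP[[c' x'] /= [cH' /WP Wx' ->]] /= e.
rewrite mem_enum in cH; rewrite mem_enum in cH'.
have [h1 h2] := HP _ cH; have [h1' h2'] := HP _ cH'.
have cc' : c = c'.
  rewrite -h2 -h2'; apply/hrho => //.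
  have -> : s c - s c' = x' - x.
    by apply/eqP; rewrite subr_eq addrAC eq_sym subr_eq [x' + _]addrC; apply/eqP.
  by apply/(hrho _ _ (WV _ Wx') (WV _ Wx)); transitivity (rho 0); [|apply/esym];
    apply/hrho; rewrite ?subr0 //; exact: WV.
by move: e; rewrite cc' => /addrI ->.
Qed.

(** * Riemann-Roch spaces and degrees *)
Section RiemannRochSpaces.
Context (F : finFieldType) (K : fieldExtType {fraction {poly F}}).
Implicit Types (v w : place K) (x y z : K) (c : F) (D E : place K -> int).

Local Notation L := riemann_roch_space.
Local Notation cardL D := #|` fset_set (L D)|.

Lemma rr_space0 D : L D 0.
Proof. by move=> v; exact: vge0. Qed.

Lemma rr_spaceB D x y : L D x -> L D y -> L D (x - y).
Proof. by move=> hx hy v; exact: vgeB (hx v) (hy v). Qed.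

Lemma rr_spaceD D x y : L D x -> L D y -> L D (x + y).
Proof. by move=> hx hy v; exact: vgeD (hx v) (hy v). Qed.

Lemma rr_spaceZ D c x : L D x -> L D (const_emb K c * x).
Proof. by move=> hx v; exact: vgeZ (hx v). Qed.

Lemma rr_space_le D E : (forall v, D v <= E v) -> L D `<=` L E.
Proof. by move=> DE x hx v; apply: vgeW (hx v); rewrite lerN2. Qed.

Definition add_place D v : place K -> int := fun w => D w + (w == v)%:Z.

(** Multiplying by a power of a uniformizer embeds the quotient of
    [L (D + v)] by [L D] into the residue field at [v]. *)
Lemma rr_space_residue D v (p : K) (T : Type) (r : K -> T) : p != 0 -> ord v p = 1 ->
  (forall x y, vge v 0 x -> vge v 0 y -> r x = r y <-> vge v 1 (x - y)) ->
  (forall x, L (add_place D v) x -> vge v 0 (x * p ^ (D v + 1))) /\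
  (forall x y, L (add_place D v) x -> L (add_place D v) y ->
    r (x * p ^ (D v + 1)) = r (y * p ^ (D v + 1)) <-> L D (x - y)).
Proof.
move=> p0 vp hr.
pose q := p ^ (D v + 1); have q0 : q != 0 by rewrite expfz_neq0.
have vq : ord v q = D v + 1 by rewrite ordXz // vp mul1r.
have Lq x : L (add_place D v) x -> vge v 0 (x * q).
  move=> /(_ v); rewrite /add_place eqxx => h.
  by rewrite -[0](addNr (D v + 1)) (vgeMl _ _ q0 vq).
split=> // x y Lx Ly.
apply: iff_trans (hr _ _ (Lq _ Lx) (Lq _ Ly)) _.
rewrite -mulrBl -[1 in X in vge _ X](subrK (D v + 1)) (vgeMl _ _ q0 vq).
rewrite opprD addrCA subrr addr0; split=> [h w|/(_ v)//].
have [->//|wv] := eqVneq w v.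
by have := rr_spaceB Lx Ly w; rewrite /add_place (negPf wv) addr0.
Qed.

End RiemannRochSpaces.

Section Ell.
Context (F : finFieldType) (K : fieldExtType {fraction {poly F}}).
Implicit Types (v w : place K) (x y z : K) (D E : place K -> int).

Local Notation L := riemann_roch_space.
Local Notation cardL D := #|` fset_set (L D)|.
Local Notation q := #|F|.

(** Since the field of constants is finite, dimensions can be read off from
    cardinals. *)
Lemma card_quot_dim0 (V : set K) n : (forall x y, V x -> V y -> V (x + y)) -> V 0 ->
  (forall c x, V x -> V (const_emb K c * x)) -> is_quot_dim V [set 0] n ->
  finite_set V /\ #|` fset_set V| = (q ^ n)%N.
Proof.
move=> VD V0 VZ [b [Vb hb]].
pose f (c : 'rV[F]_n) := \sum_i const_emb K (c 0 i) * b i.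
have Vf c : V (f c) by apply: big_ind => // i _; exact: VZ.
have -> : (q ^ n = size [seq f c | c <- enum {: 'rV[F]_n}])%N.
  by rewrite size_map -cardE card_mx mul1n.
apply: card_set_seq => [x|].
  split=> [Vx|/mapP[c _ ->]//]; have [c [/eqP h _]] := hb x Vx.
  apply/mapP; exists c; first by rewrite mem_enum.
  by apply/eqP; rewrite -subr_eq0.
rewrite map_inj_uniq ?enum_uniq // => c c' e.
have [d [_ hd]] := hb _ (Vf c).
transitivity d; [apply/esym|]; apply: hd => /=; first exact: subrr.
by rewrite [f c]e; exact: subrr.
Qed.

Lemma finite_quot_dim0 (V : set K) : (forall x y, V x -> V y -> V (x + y)) -> V 0 ->
  (forall c x, V x -> V (const_emb K c * x)) -> finite_set V ->
  exists n, is_quot_dim V [set 0] n.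
Proof.
move=> VD V0 VZ finV.
apply: (@quot_dim_exists _ _ _ _ #|` fset_set V|) => [x y -> ->|c x ->|y Vy].
- exact: addr0.
- exact: mulr0.
set M := #|` fset_set V|.
pose f (c : 'rV[F]_M.+1) := \sum_i const_emb K (c 0 i) * y i.
have Vf c : f c \in fset_set V.
  by rewrite in_fset_set // mem_set //; apply: big_ind => // i _; exact: VZ.
have /injectivePn[c [c' cc' e]] : ~~ injectiveb (fun c => [` Vf c]%fset).
  apply/negP => /injectiveP/leq_card; rewrite card_mx mul1n -cardfE.
  by rewrite leqNgt (leq_trans _ (ltnW (ltn_expl _ (finNzRing_gt1 F)))) ?ltnSn.
exists (c - c'); split; first by rewrite subr_eq0.
move/(congr1 val): e => /= e.
transitivity (f c - f c'); last by rewrite e subrr.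
by rewrite -sumrB; apply: eq_bigr => i _; rewrite !mxE rmorphB mulrBl.
Qed.

Lemma card_ell D : finite_set (L D) -> cardL D = (q ^ ell D)%N.
Proof.
move=> finL.
have h : exists n, is_quot_dim (L D) [set 0] n.
  by apply: finite_quot_dim0 => //; [exact: rr_spaceD|exact: rr_space0|exact: rr_spaceZ].
have := xgetPex 0%N h; rewrite -[xget _ _]/(ell D).
by case/(card_quot_dim0 (@rr_spaceD _ _ D) (rr_space0 D) (@rr_spaceZ _ _ D)).
Qed.

(** [ell] takes the default value 0 on spaces of infinite dimension. *)
Lemma finite_of_ell D : ell D != 0%N -> finite_set (L D).
Proof.
move=> l0; have [h|h] := pselect (exists n, is_quot_dim (L D) [set 0] n).
  have := xgetPex 0%N h.
  by case/(card_quot_dim0 (@rr_spaceD _ _ D) (rr_space0 D) (@rr_spaceZ _ _ D)).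
by move: l0; rewrite /ell /quot_dim xgetPN ?eqxx // => n hn; apply: h; exists n.
Qed.

Local Notation deg := divisor_degree.

Lemma deg_seq D (A : {fset place K}) : (forall v, v \notin A -> D v = 0) ->
  deg D = \sum_(v <- A) D v * (residue_degree v)%:Z.
Proof. by move=> h; rewrite /deg (fsbigTE A) // => v /h ->; rewrite mul0r. Qed.

Lemma divisor_fset D : divisor D -> exists A : {fset place K}, forall v, v \notin A -> D v = 0.
Proof.
move=> dD; exists (fset_set [set v | D v != 0]) => v.
by rewrite in_fset_set // notin_setE /= => /negP; rewrite negbK => /eqP.
Qed.

Lemma divisor_of_fset D (A : {fset place K}) : (forall v, v \notin A -> D v = 0) -> divisor D.
Proof.
move=> h; apply: (sub_finite_set _ (finite_fset A)) => v /= Dv.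
by apply: contraNT Dv => /h ->.
Qed.

Lemma divisorD D E : divisor D -> divisor E -> divisor (fun v => D v + E v).
Proof.
move=> /divisor_fset[A hA] /divisor_fset[B hB].
apply: (@divisor_of_fset _ (A `|` B)%fset) => v; rewrite inE negb_or => /andP[/hA -> /hB ->].
by rewrite addr0.
Qed.

Lemma deg_addD D E : divisor D -> divisor E -> deg (fun v => D v + E v) = deg D + deg E.
Proof.
move=> /divisor_fset[A hA] /divisor_fset[B hB].
have hA' v : v \notin (A `|` B)%fset -> D v = 0 by rewrite inE negb_or => /andP[/hA].
have hB' v : v \notin (A `|` B)%fset -> E v = 0 by rewrite inE negb_or => /andP[_ /hB].
rewrite (deg_seq hA') (deg_seq hB') (deg_seq (A := (A `|` B)%fset)); last first.
  by move=> v hv; rewrite hA' // hB'.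
by rewrite -big_split; apply: eq_bigr => v _; rewrite mulrDl.
Qed.

Lemma divisorZ n D : divisor D -> divisor (fun v => n * D v).
Proof.
move=> /divisor_fset[A hA]; apply: (@divisor_of_fset _ A) => v /hA ->; exact: mulr0.
Qed.

Lemma deg_scale n D : divisor D -> deg (fun v => n * D v) = n * deg D.
Proof.
move=> /divisor_fset[A hA]; rewrite !(deg_seq (A := A)) //; last by move=> v /hA ->; exact: mulr0.
by rewrite mulr_sumr; apply: eq_bigr => v _; rewrite mulrA.
Qed.

Definition place_div v : place K -> int := fun w => (w == v)%:Z.

Lemma divisor_place v : divisor (place_div v).
Proof.
by apply: (@divisor_of_fset _ [fset v]%fset) => w; rewrite inE /place_div => /negPf ->.
Qed.

Lemma deg_place v : deg (place_div v) = (residue_degree v)%:Z.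
Proof.
rewrite (deg_seq (A := [fset v]%fset)); last by move=> w; rewrite inE /place_div => /negPf ->.
by rewrite big_seq_fset1 /place_div eqxx mul1r.
Qed.

Lemma divisor0 : divisor ((fun=> 0) : place K -> int).
Proof. by apply: (@divisor_of_fset _ fset0). Qed.

Lemma deg_zero : deg ((fun=> 0) : place K -> int) = 0.
Proof. by rewrite (deg_seq (A := fset0)) // big_seq_fset0. Qed.

Lemma deg_ge0 D : (forall v, 0 <= D v) -> divisor D -> 0 <= deg D.
Proof.
move=> D0 /divisor_fset[A hA]; rewrite (deg_seq (A := A)) //.
by apply: sumr_ge0 => v _; rewrite mulr_ge0.
Qed.

Lemma divisor_ind (P : (place K -> int) -> Prop) D E :
  divisor D -> divisor E -> (forall v, D v <= E v) ->
  P D -> (forall D' v, divisor D' -> P D' -> P (add_place D' v)) -> P E.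
Proof.
move=> dD /divisor_fset[B hB] DE PD Pstep; have [A hA] := divisor_fset dD.
have h v : v \notin (A `|` B)%fset -> D v = E v.
  by rewrite inE negb_or => /andP[/hA -> /hB ->].
have [n] := ubnP (\sum_(v <- (A `|` B)%fset) `|E v - D v|)%N.
move: dD DE PD h; move: (A `|` B)%fset => C {hA hB}.
elim: n D => // n IH D dD DE PD h hn.
have [eDE|[v Dv]] : D = E \/ exists v, D v < E v.
- have [h'|h'] := pselect (exists v, D v < E v); [by right|left; apply/funext => v].
  by apply/eqP; rewrite eq_le DE leNgt; apply/negP => h''; apply: h'; exists v.
- by rewrite -eDE.
have vC : v \in C by apply: contraLR Dv => /h ->; rewrite ltxx.
have hw w : D w <= add_place D v w <= E w.
  rewrite /add_place lerDl lez_nat /=; case: eqP => [->|_]; last by rewrite addr0.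
  by rewrite lezD1.
apply: (IH (add_place D v)).
- by apply: divisorD => //; exact: divisor_place.
- by move=> w; case/andP: (hw w).
- exact: Pstep.
- move=> w wC; apply/eqP; rewrite eq_le; case/andP: (hw w) => h1 ->.
  by rewrite -h.
rewrite -ltnS; apply: leq_trans hn; rewrite ltnS.
rewrite !(big_fsetD1 v vC) /= -addSn leq_add //.
  by rewrite /add_place eqxx; lia.
by apply: leq_sum => w _; case/andP: (hw w); lia.
Qed.

End Ell.

(** * Consequences of the genus bound *)
Section Genus.
Context (F : finFieldType) (K : fieldExtType {fraction {poly F}}).
Implicit Types (v w : place K) (x y z : K) (c : F) (D E : place K -> int).
Context (hK : full_constant_field K) (g : nat) (hg : is_genus K g).

Local Notation L := riemann_roch_space.
Local Notation deg := divisor_degree.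
Local Notation cardL D := #|` fset_set (L D)|.
Local Notation q := #|F|.
Local Notation zerodiv := ((fun=> 0) : place K -> int).

Lemma ell_ge D : divisor D -> deg D + 1 - g%:Z <= (ell D)%:Z.
Proof. by move=> /(proj1 hg); lia. Qed.

Lemma place_inhabited : exists v : place K, True.
Proof. by have [v hv] := exists_place K; exists (SigSub (mem_set hv)). Qed.

(** The genus bound gives a multiple of a place whose space has nonzero
    dimension, hence is finite; it contains the space of the zero divisor. *)
Lemma finite_rr_space0 : finite_set (L zerodiv).
Proof.
have [v _] := place_inhabited.
pose D w : int := g.+1%:Z * place_div v w.
have dD : divisor D by apply: divisorZ; exact: divisor_place.
have fD : finite_set (L D).
  apply: finite_of_ell; have := ell_ge dD.
  rewrite /D deg_scale ?deg_place; last exact: divisor_place.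
  have := residue_degree_gt0 v; case: (ell _) => //; nia.
by apply: sub_finite_set fD; apply: rr_space_le => w; rewrite /D /place_div mulr_ge0.
Qed.

(** The powers of an element without poles remain in a finite set, so that such
    an element is algebraic over the constants. *)
Lemma rr_space0_const x : L zerodiv x <-> exists c, x = const_emb K c.
Proof.
split=> [hx|[c ->] v]; last by rewrite oppr0; exact: vge_const.
apply: hK; have hX n : L zerodiv (x ^+ n).
  by move=> v; rewrite oppr0; apply: vgeX; have := hx v; rewrite oppr0.
have [i [j [ij e]]] : exists i j, (i < j)%N /\ x ^+ i = x ^+ j.
  pose M := #|` fset_set (L zerodiv)|.
  have Vf (i : 'I_M.+1) : x ^+ i \in fset_set (L zerodiv).
    by rewrite in_fset_set ?mem_set //; exact: finite_rr_space0.
  have /injectivePn[i [j ij e]] : ~~ injectiveb (fun i => [` Vf i]%fset).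
    by apply/negP => /injectiveP/leq_card; rewrite card_ord -cardfE ltnn.
  move/(congr1 val): e => /= e; case: (ltngtP i j) => h; [by exists i, j|by exists j, i|].
  by move: ij; rewrite (val_inj h) eqxx.
exists ('X^j - 'X^i : {poly F}).
  rewrite subr_eq0; apply: contraTneq ij => /(congr1 (fun p : {poly F} => size p)).
  by rewrite !size_polyXn => -[->]; rewrite ltnn.
by rewrite rmorphB /= !map_polyXn rootE hornerD hornerN !hornerXn e subrr.
Qed.

Lemma card_rr_space0 : cardL zerodiv = q.
Proof.
have -> : q = size [seq const_emb K c | c <- enum F] by rewrite size_map -cardE.
apply: proj2; apply: card_set_seq => [x|].
  rewrite rr_space0_const; split=> [[c ->]|/mapP[c _ ->]]; last by exists c.
  by apply/mapP; exists c; rewrite ?mem_enum.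
by rewrite map_inj_uniq ?enum_uniq //; exact: fmorph_inj.
Qed.

Lemma ell0 : ell zerodiv = 1%N.
Proof.
have := card_ell finite_rr_space0; rewrite card_rr_space0 -[X in X = _]expn1.
by move=> /(expnI (finNzRing_gt1 F)).
Qed.

Definition div_of y : place K -> int := fun v => ord v y.

Lemma divisor_div y : y != 0 -> divisor (div_of y).
Proof.
move=> y0; have y0' : y^-1 != 0 by rewrite invr_eq0.
apply: (@sub_finite_set _ _ ([set v | 0 < ord v y] `|` [set v | 0 < ord v y^-1])).
  by move=> v /=; rewrite neq_lt ordV // oppr_gt0 => /orP[]; [right|left].
by rewrite finite_setU; split; exact: finite_zeros.
Qed.

(** Half of the product formula.  For every k the space of k div(y) consists of
    the constant multiples of y^-k, so its dimension is 1 and the genus bound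
    reads k deg(div y) <= g. *)
Lemma deg_div_le0 y : y != 0 -> deg (div_of y) <= 0.
Proof.
move=> y0; have dy := divisor_div y0.
rewrite leNgt; apply/negP => h.
pose k := g.+1; pose D v : int := k%:Z * div_of y v.
have dD : divisor D by exact: divisorZ.
have yk0 : y ^+ k != 0 by rewrite expf_neq0.
have vD x v : vge v (- D v) x = vge v (- 0) (x * y ^+ k).
  rewrite -(vgeMl _ _ yk0 (erefl (ord v (y ^+ k)))) ordX // /D /div_of.
  by rewrite -mulr_natl natz addNr oppr0.
have LDE x : L D x <-> L zerodiv (x * y ^+ k).
  by split=> hx v; have := hx v; have := vD x v; rewrite /vge => ->.
have card : finite_set (L D) /\ cardL D = q.
  have -> : q = size [seq const_emb K c / y ^+ k | c <- enum F] by rewrite size_map -cardE.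
  apply: card_set_seq => [x|].
    rewrite LDE rr_space0_const; split=> [[c e]|/mapP[c _ ->]].
      by apply/mapP; exists c; rewrite ?mem_enum // -e mulfK.
    by exists c; rewrite divfK.
  rewrite map_inj_uniq ?enum_uniq // => c c' /(mulIf _) e.
  by apply: (fmorph_inj (const_emb K)); apply: e; rewrite invr_eq0.
have lD : ell D = 1%N.
  have := card_ell (proj1 card); rewrite (proj2 card) -[X in X = _]expn1.
  by move=> /(expnI (finNzRing_gt1 F)).
by have := ell_ge dD; rewrite lD /D deg_scale // /k; nia.
Qed.

Lemma deg_ge0_of_rr_space D y : divisor D -> L D y -> y != 0 -> 0 <= deg D.
Proof.
move=> dD hy y0; have dy := divisor_div y0.
have := deg_ge0 (D := fun v => D v + div_of y v) _ (divisorD dD dy).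
rewrite deg_addD // => h; apply: le_trans (h _) _; last by rewrite gerDl deg_div_le0.
by move=> v; have := hy v; rewrite -[(_ <= _)%E]/(vge _ _ _) vge_ord // /div_of; lia.
Qed.

Lemma deg_add D v : divisor D -> deg (add_place D v) = deg D + (residue_degree v)%:Z.
Proof. by move=> dD; rewrite (deg_addD dD (divisor_place v)) deg_place. Qed.

Lemma divisor_add D v : divisor D -> divisor (add_place D v).
Proof. by move=> dD; exact: divisorD (divisor_place v). Qed.

(** The quotient of the spaces of [D + v] and [D] is counted by the residues that
    are attained; keeping them explicit allows to detect equality. *)
Lemma card_rr_space_step D v (p : K) (T : finType) (r : K -> T) : p != 0 -> ord v p = 1 ->
  (forall x y, vge v 0 x -> vge v 0 y -> r x = r y <-> vge v 1 (x - y)) ->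
  finite_set (L D) -> finite_set (L (add_place D v)) /\
  cardL (add_place D v) =
    (#|[set c : T | `[< exists2 x, L (add_place D v) x & r (x * p ^ (D v + 1))%R = c >]]%SET|
      * cardL D)%N.
Proof.
move=> p0 vp hr fD; have [_ hrho] := rr_space_residue D p0 vp hr.
apply: (card_extension (rr_space0 _) (@rr_spaceB _ _ _) fD _ hrho).
by apply: rr_space_le => w; rewrite /add_place lerDl.
Qed.

Lemma ell_step D v : finite_set (L D) -> finite_set (L (add_place D v)) /\
  (ell (add_place D v) <= ell D + residue_degree v)%N.
Proof.
move=> fD; have [p p0 vp] := exists_ord1 v; have [r [hr _]] := residue_map v.
have [fDv e] := card_rr_space_step p0 vp hr fD; split => //.
rewrite -(leq_exp2l _ _ (finNzRing_gt1 F)) -card_ell // e expnD -card_ell // mulnC.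
by rewrite leq_mul2l (leq_trans (max_card _)) ?orbT // card_mx mul1n.
Qed.

Lemma ell_le D E : divisor D -> divisor E -> (forall v, D v <= E v) ->
  finite_set (L D) ->
  finite_set (L E) /\ (ell E)%:Z - deg E <= (ell D)%:Z - deg D.
Proof.
move=> dD dE DE fD.
pose P E := [/\ divisor E, finite_set (L E) & (ell E)%:Z - deg E <= (ell D)%:Z - deg D].
suff : P E by case.
apply: (divisor_ind dD dE DE); first by split.
move=> D' v _ [dD' fD' hD']; have [fDv hDv] := ell_step v fD'.
by split => //; [exact: divisor_add|rewrite deg_add //; lia].
Qed.

Let le_max0 (a : int) : 0 <= Num.max a 0.
Proof. by rewrite le_max lexx orbT. Qed.

Lemma finite_rr_space D : divisor D -> finite_set (L D).
Proof.
move=> dD; pose E v := Num.max (D v) 0.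
have dE : divisor E.
  have [A hA] := divisor_fset dD; apply: (@divisor_of_fset _ _ _ A) => v /hA.
  by rewrite /E => ->; rewrite maxxx.
have [fE _] := ell_le (@divisor0 _ _) dE (fun v => le_max0 (D v)) finite_rr_space0.
by apply: sub_finite_set fE; apply: rr_space_le => v; rewrite /E le_max lexx.
Qed.

Lemma ell_le_effective D : divisor D -> (forall v, 0 <= D v) -> (ell D)%:Z <= deg D + 1.
Proof.
move=> dD D0; have [_] := ell_le (@divisor0 _ _) dD D0 finite_rr_space0.
by rewrite ell0 deg_zero; lia.
Qed.

End Genus.

(** * Genus zero and one, and the number of places of given degree *)
Section GenusMore.
Context (F : finFieldType) (K : fieldExtType {fraction {poly F}}).
Implicit Types (v w : place K) (x y z : K) (c : F) (D E : place K -> int).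
Context (hK : full_constant_field K) (g : nat) (hg : is_genus K g).

Local Notation L := riemann_roch_space.
Local Notation deg := divisor_degree.
Local Notation cardL D := #|` fset_set (L D)|.
Local Notation q := #|F|.
Local Notation zerodiv := ((fun=> 0) : place K -> int).

Lemma rr_space_nonzero D : ell D != 0%N -> exists2 y, L D y & y != 0.
Proof.
move=> l0; apply: contrapT => h; have fD := finite_of_ell l0.
have := card_ell fD; suff -> : L D = [set 0].
  rewrite fset_set1 cardfs1 => /eqP; rewrite eq_sym -[X in _ == X](expn0 q).
  by rewrite eqn_exp2l ?finNzRing_gt1 // (negPf l0).
apply/seteqP; split=> [x Lx|x ->]; last exact: rr_space0.
by apply/eqP; apply: contrapT => /negP x0; apply: h; exists x.
Qed.

(** Multiplication by [y] identifies the two spaces. *)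
Lemma ell_shift D y : y != 0 -> finite_set (L D) ->
  finite_set (L (fun v => D v - ord v y)) /\ ell (fun v => D v - ord v y) = ell D.
Proof.
move=> y0 fD; set E := fun v => _.
have LE x : L E (x * y) <-> L D x.
  suff h v : vge v (- E v) (x * y) = vge v (- D v) x.
    by split=> hx v; have := hx v; have := h v; rewrite /vge => ->.
  by rewrite -(vgeMl _ x y0 (erefl (ord v y))) /E opprB addrC.
have [fE cE] : finite_set (L E) /\ cardL E = size [seq x * y | x <- fset_set (L D)].
  apply: card_set_seq; last by rewrite map_inj_uniq ?fset_uniq //; exact: mulIf.
  move=> x; rewrite -[x](divfK y0) LE; split=> [h|/mapP[z]].
    by apply/mapP; exists (x / y) => //; rewrite in_fset_set // mem_set.
  by rewrite in_fset_set // => /set_mem Lz /(mulIf y0) ->.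
split => //; apply: (expnI (finNzRing_gt1 F)).
by rewrite -!card_ell // cE size_map.
Qed.

Definition mult_place (k : nat) v : place K -> int := fun w => k%:Z * place_div v w.

Lemma mult_placeS k v : mult_place k.+1 v = add_place (mult_place k v) v.
Proof. by apply/funext => w; rewrite /mult_place /add_place /place_div intS mulrDl mul1r addrC. Qed.

Lemma mult_place0 v : mult_place 0 v = zerodiv.
Proof. by apply/funext => w; rewrite /mult_place mul0r. Qed.

Lemma mult_place_self k v : mult_place k v v = k%:Z.
Proof. by rewrite /mult_place /place_div eqxx mulr1. Qed.

Lemma divisor_mult_place k v : divisor (mult_place k v).
Proof. by apply: divisorZ; exact: divisor_place. Qed.

Lemma deg_mult_place k v : deg (mult_place k v) = k%:Z * (residue_degree v)%:Z.
Proof. by rewrite deg_scale ?deg_place //; exact: divisor_place. Qed.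

(** The hypothesis says that the space of [v] surjects onto the residue field at
    [v].  Products of its elements show that the space of [k v] does so too for
    every [k], and [ell (k v)] is then as large as possible. *)
Lemma ell_mult_place v : (residue_degree v < ell (mult_place 1 v))%N ->
  forall k, (k * residue_degree v < ell (mult_place k v))%N.
Proof.
move=> lv; set d := residue_degree v in lv *.
have [p p0 vp] := exists_ord1 v; have [r [hr rsurj]] := residue_map v.
have q1 := finNzRing_gt1 F.
have fL k : finite_set (L (mult_place k v)) by apply: (finite_rr_space hg); exact: divisor_mult_place.
have Lsurj1 z : vge v 0 z -> exists2 x, L (mult_place 1 v) x & vge v 1 (x * p - z).
  move=> vz; move: lv; rewrite mult_placeS mult_place0.
  have [h1 h2] := rr_space_residue zerodiv p0 vp hr.
  have [fLv] := card_rr_space_step p0 vp hr (finite_rr_space0 hg).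
  set H := [set c | _]%SET => cH; rewrite -(leq_exp2l _ _ q1) -card_ell // cH.
  rewrite (card_rr_space0 hK hg) mulnC expnS leq_pmul2l ?(ltnW q1) // => hH.
  have HT : H = [set: 'rV[F]_d]%SET.
    by apply/eqP; rewrite eqEcard finset.subsetT cardsT card_mx mul1n.
  have : r z \in H by rewrite HT inE.
  rewrite inE => /asboolP[x Lx]; have vx := h1 _ Lx.
  by rewrite add0r expr1z in vx * => /(hr _ _ vx vz) hx; exists x.
have Lsurj k z : vge v 0 z -> exists2 x, L (mult_place k.+1 v) x & vge v 1 (x * p ^+ k.+1 - z).
  elim: k z => [|k IH] z vz; first by rewrite expr1; exact: Lsurj1.
  have [x Lx hx] := IH z vz.
  have [|y Ly hy] := Lsurj1 1; first by rewrite vge_ord ?oner_neq0 // ord_one.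
  exists (x * y).
    move=> w; have := vgeM (Lx w) (Ly w); congr (is_true (vge w _ _)).
    by rewrite /mult_place; ring.
  have -> : x * y * p ^+ k.+2 - z = (x * p ^+ k.+1 - z) * (y * p) + z * (y * p - 1).
    by rewrite exprSr; ring.
  apply: vgeD; last by rewrite -[1 in X in vge _ X](add0r 1); exact: vgeM.
  rewrite -[1 in X in vge _ X](addr0 1); apply: vgeM => //.
  rewrite -[_ * _](subrK 1); apply: vgeD; first by apply: vgeW hy.
  by rewrite vge_ord ?oner_neq0 // ord_one.
have cS k : cardL (mult_place k.+1 v) = (q ^ d * cardL (mult_place k v))%N.
  rewrite mult_placeS; have [_ ->] := card_rr_space_step p0 vp hr (fL k); congr (_ * _)%N.
  transitivity #|{: 'rV[F]_d}|; last by rewrite card_mx mul1n.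
  apply: eq_card => c; rewrite !inE; apply/asboolP.
  have [z vz rz] := rsurj c; have [x Lx hx] := Lsurj k z vz.
  have [h1 h2] := rr_space_residue (mult_place k v) p0 vp hr.
  rewrite mult_placeS in Lx; exists x => //; rewrite -rz; apply/hr => //; first exact: h1.
  by rewrite mult_place_self -PoszD addn1 -exprnP.
elim=> [|k IH]; first by rewrite mult_place0 (ell0 hK hg).
rewrite -(ltn_exp2l _ _ q1) -card_ell // cS card_ell // -expnD ltn_exp2l //.
by rewrite mulSn ltn_add2l.
Qed.

(** The argument takes the place of duality.  The defect deg - ell + 1 is
    nondecreasing in the divisor and equals 1 at some divisor D.  Were ell(v)
    larger than deg(v), it would be at most 0 at all multiples of [v].  But for
    large [k] there is a nonzero y in the space of [k v - D], and D - div(y) is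
    then a divisor below [k v] with the same dimension as D and no smaller
    degree, hence of defect at least 1. *)
Lemma ell_place_genus1 v : g = 1%N -> (ell (mult_place 1 v) <= residue_degree v)%N.
Proof.
move=> g1; rewrite leqNgt; apply/negP => lv.
have [D [dD eD]] := proj2 hg; rewrite g1 in eD.
have d0 := residue_degree_gt0 v.
pose k := `|deg D|.+1%N; pose E w := mult_place k v w + (- 1) * D w.
have dD' : divisor (fun w => - 1 * D w) by exact: divisorZ.
have dE : divisor E by apply: divisorD => //; exact: divisor_mult_place.
have degE : deg E = k%:Z * (residue_degree v)%:Z - deg D.
  by rewrite (deg_addD (divisor_mult_place k v) dD') deg_mult_place deg_scale // mulN1r.
have [|y Ly y0] := @rr_space_nonzero E.
  by have := ell_ge hg dE; rewrite degE g1 /k; case: (ell E) => //; nia.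
have [fDy lDy] := ell_shift y0 (finite_rr_space hg dD).
have dDy : divisor (fun w => D w - ord w y).
  apply: divisorD => //; apply: (@divisor_of_fset _ _ _ (fset_set [set v | div_of y v != 0])) => w.
  rewrite in_fset_set; last exact: divisor_div.
  by rewrite notin_setE /= => /negP; rewrite negbK /div_of => /eqP ->; rewrite oppr0.
have degDy : deg D <= deg (fun w => D w - ord w y).
  have := deg_div_le0 hK hg y0.
  have -> : deg D = deg (fun w => (D w - ord w y) + div_of y w).
    by congr (deg _); apply/funext => w; rewrite subrK.
  by rewrite deg_addD //; [lia|exact: divisor_div].
have [|_ h] := @ell_le _ _ (fun w => D w - ord w y) (mult_place k v) dDy (divisor_mult_place _ _) _ fDy.
  by move=> w; have := Ly w; rewrite -[(_ <= _)%E]/(vge _ _ _) vge_ord // /E; lia.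
by have := ell_mult_place lv k; rewrite lDy deg_mult_place in h; lia.
Qed.

Lemma ell_genus0 D : g = 0%N -> divisor D -> (forall v, 0 <= D v) ->
  (ell D)%:Z = deg D + 1.
Proof.
move=> g0 dD D0; apply/eqP; rewrite eq_le (ell_le_effective hK hg) //=.
by have := ell_ge hg dD; rewrite g0 subr0.
Qed.

Lemma ell_genus1 D : g = 1%N -> divisor D -> (forall v, 0 <= D v) -> D <> zerodiv ->
  (ell D)%:Z = deg D.
Proof.
move=> g1 dD D0 nD; apply/eqP; rewrite eq_le; apply/andP; split; last first.
  by have := ell_ge hg dD; rewrite g1 addrK.
have [v Dv] : exists v, 0 < D v.
  apply: contrapT => h; apply: nD; apply/funext => v; apply/eqP.
  by rewrite eq_le D0 andbT leNgt; apply/negP => Dv; apply: h; exists v.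
have dv := divisor_mult_place 1 v.
have [|_] := ell_le dv dD _ (finite_rr_space hg dv).
  move=> w; rewrite /mult_place /place_div mul1r; case: eqP => // ->.
  by rewrite -gtz0_ge1.
by have := ell_place_genus1 v g1; rewrite deg_mult_place; lia.
Qed.

(** Fix a place P and choose [k] with [k deg P] slightly larger than [n].  Each
    place [v] of degree [n] is a zero, relative to [k P], of a nonzero element
    of the space of [k P], which has O(q^n) elements; and each element serves
    boundedly many [v], since these zeros have total degree at most
    [k deg P]. *)
Lemma count_places : exists C, forall n (A : {fset place K}),
  (forall v, v \in A -> residue_degree v = n) -> (#|` A| <= C * q ^ n)%N.
Proof.
have [P _] := @place_inhabited F K; set p := residue_degree P.
have p0 : (0 < p)%N by exact: residue_degree_gt0.
exists ((1 + g + p) * q ^ (g + p + 1))%N => n A hA.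
have q1 := finNzRing_gt1 F.
(* the least [k] with [n + g < k * p], so that [ell (k P - v)] is positive *)
pose k := ((n + g) %/ p).+1.
have kp1 : (n + g < k * p)%N by rewrite /k ltn_ceil.
have kp2 : (k * p <= n + g + p)%N by rewrite /k mulSn addnC leq_add2r leq_divM.
have /choice[y hy] v : exists y, v \in A ->
    y != 0 /\ L (fun w => mult_place k P w + (- 1) * place_div v w) y.
  have [vA|_] := boolP (v \in A); last by exists 0.
  have dv1 : divisor (fun w => - 1 * place_div v w) by apply: divisorZ; exact: divisor_place.
  have dv := divisorD (divisor_mult_place k P) dv1.
  have [|x Lx x0] := @rr_space_nonzero (fun w => mult_place k P w + (- 1) * place_div v w).
    have := ell_ge hg dv; rewrite (deg_addD (divisor_mult_place k P) dv1).
    rewrite deg_mult_place (deg_scale _ (divisor_place v)) deg_place (hA v) //.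
    by case: (ell _) => //; rewrite -/p; lia.
  by exists x.
have dk := divisor_mult_place k P.
have fL := finite_rr_space hg dk; set Lk := fset_set (L (mult_place k P)).
have yL v : v \in A -> y v \in Lk.
  move=> /hy[_ Ly]; rewrite in_fset_set // mem_set //; apply: rr_space_le Ly => w.
  by rewrite mulN1r gerBl /place_div.
have cLk : (#|` Lk| <= q ^ (n + g + p + 1))%N.
  rewrite /Lk card_ell // leq_exp2l //.
  have := ell_le_effective hK hg dk; rewrite deg_mult_place -/p => h.
  suff : ((ell (mult_place k P))%:Z <= k%:Z * p%:Z + 1) by lia.
  by apply: h => w; rewrite /mult_place mulr_ge0.
have fib z : z \in Lk -> (count (fun v => y v == z) A <= 1 + g + p)%N.
  move=> zL; rewrite -size_filter; set B := [seq v <- A | _].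
  have [B0|[v0 v0B]] : B = [::] \/ exists v, v \in B.
  - by case: B => [|v B]; [left|right; exists v; rewrite inE eqxx].
  - by rewrite B0.
  have BP v : v \in B -> v \in A /\ y v = z by rewrite mem_filter => /andP[/eqP].
  have uB : uniq B by rewrite filter_uniq // fset_uniq.
  pose indB w : int := (w \in B)%:Z.
  have indB0 w : w \notin [fset v in B]%fset -> indB w = 0 by rewrite inE /indB => /negPf ->.
  have dB : divisor indB by exact: divisor_of_fset indB0.
  have degB : deg indB = (n * size B)%N%:Z.
    rewrite (deg_seq indB0); transitivity (\sum_(v <- B) n%:Z).
      rewrite (perm_big B) /=; last by apply: uniq_perm => // v; rewrite inE.
      apply: eq_big_seq => v vB; rewrite /indB vB mul1r (hA v) //.
      by case: (BP v vB).
    by rewrite big_const_seq count_predT iter_addr_0 -mulr_natr natz -PoszM.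
  have dB' : divisor (fun w => - 1 * indB w) by exact: divisorZ.
  have [z0 Lz0] : z != 0 /\ L (fun w => mult_place k P w + (- 1) * indB w) z.
    split=> [|w]; first by case: (BP _ v0B) => /hy[y0 _] <-.
    have [wB|wB] := boolP (w \in B).
      have [wA yw] := BP _ wB; have [_ /(_ w)] := hy _ wA.
      by rewrite yw /indB wB /place_div eqxx.
    have [v0A yv] := BP _ v0B; have [_ /(_ w)] := hy _ v0A.
    rewrite yv /indB (negPf wB) /place_div; case: eqP => // wv.
    by rewrite -wv in v0B; rewrite v0B in wB.
  have := deg_ge0_of_rr_space hK hg (divisorD dk dB') Lz0 z0.
  rewrite (deg_addD dk dB') deg_mult_place deg_scale // -/p degB.
  have n0 : (0 < n)%N by rewrite -(hA v0 (BP _ v0B).1) residue_degree_gt0.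
  move=> h; rewrite -(leq_pmul2l n0); apply: (@leq_trans (n + g + p)); last by nia.
  by apply: leq_trans kp2; move: h; rewrite -PoszM mulN1r subr_ge0 lez_nat.
apply: (@leq_trans (\sum_(z <- Lk) count (fun v => y v == z) A)%N).
  under eq_bigr do rewrite -sum1_count big_mkcond.
  rewrite exchange_big /= -sum1_size big_seq [X in (_ <= X)%N]big_seq; apply: leq_sum => v vA.
  by rewrite (big_rem (y v)) ?yL //= eqxx leq_addr.
rewrite big_seq (leq_trans (leq_sum _ fib)) // -big_seq big_const_seq count_predT iter_addn_0.
by rewrite -mulnA -expnD leq_mul2l; apply/orP; right; apply: leq_trans cLk _; rewrite leq_exp2l //; lia.
Qed.

End GenusMore.

(** * Sums over boxes of pole orders *)
Section PoleOrder.
Context (F : finFieldType) (K : fieldExtType {fraction {poly F}}).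
Implicit Types (v : place K) (x : K).

(** This is 0 at x = 0 thanks to the default value of [ord]. *)
Definition pole_order v x : nat := if ord v x < 0 then `|ord v x|%N else 0%N.

Lemma pole_order_le v x n : (pole_order v x <= n)%N = vge v (- n%:Z) x.
Proof.
have [->|x0] := eqVneq x 0; first by rewrite vge0 /pole_order /ord val_zero.
by rewrite vge_ord // /pole_order; case: ltP => h; lia.
Qed.

End PoleOrder.

Section BoxSums.
Context (F : finFieldType) (K : fieldExtType {fraction {poly F}}).
Implicit Types (v w : place K) (x y z : K) (c : F) (D E : place K -> int).
Context (hK : full_constant_field K) (g : nat) (hg : is_genus K g).
Context (hg01 : g = 0%N \/ g = 1%N).

Local Notation L := riemann_roch_space.
Local Notation deg := divisor_degree.
Local Notation cardL D := #|` fset_set (L D)|.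
Local Notation q := #|F|.
Local Notation zerodiv := ((fun=> 0) : place K -> int).

(** Riemann-Roch for effective divisors; the correction term comes from the zero
    divisor in genus one, where the dimension is 1 instead of 0. *)
Lemma card_rr_space_effective D : divisor D -> (forall v, 0 <= D v) ->
  cardL D = (q ^ (1 - g) * q ^ `|deg D| + `[< g = 1 /\ D = zerodiv >] * (q - 1))%N.
Proof.
move=> dD D0; have q1 := finNzRing_gt1 F; rewrite card_ell; last exact: finite_rr_space hg _ dD.
have dD0 := deg_ge0 D0 dD.
case: hg01 => g0.
  rewrite asboolF; last by rewrite g0 => -[].
  rewrite mul0n addn0 g0 subn0 -expnD; congr (q ^ _)%N.
  by have := ell_genus0 hK hg g0 dD D0; lia.
have [Dz|Dz] := pselect (D = zerodiv).
  rewrite asboolT // Dz (ell0 hK hg) deg_zero g0 subnn !expn0 !mul1n expn1.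
  by rewrite subnKC // ltnW.
rewrite asboolF; last by case.
rewrite mul0n addn0 g0 subnn expn0 mul1n; congr (q ^ _)%N.
by have := ell_genus1 hK hg g0 dD D0 Dz; lia.
Qed.

Section Box.
Context (T : comNzRingType) (w : place K -> nat -> T) (A : {fset place K}) (n : nat).

(** The weight of a pole order up to [n] is the sum of the drops from that order
    up to [n].  The point of this decomposition is that bounding pole orders
    from above defines a Riemann-Roch space, while prescribing them does not. *)
Definition weight_drop v j : T := if (j < n)%N then w v j - w v j.+1 else w v j.

Lemma sum_weight_drop v k : (k <= n)%N ->
  \sum_(j < n.+1) weight_drop v j *+ (k <= j)%N = w v k.
Proof.
move=> kn; rewrite big_ord_recr /= /weight_drop ltnn kn.
suff -> : \sum_(i < n) (if (i < n)%N then w v i - w v i.+1 else w v i) *+ (k <= i)%N = w v k - w v n.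
  by rewrite subrK.
under eq_bigr => i _ do rewrite ltn_ord.
elim: n kn => [|m IH]; first by rewrite leqn0 => /eqP->; rewrite big_ord0 subrr.
rewrite leq_eqVlt ltnS => /predU1P[->|km].
  by rewrite subrr big1 // => i _; rewrite leqNgt ltn_ord mulr0n.
by rewrite big_ord_recr /= IH // km mulr1n addrA subrK.
Qed.

Definition box_divisor (m : place K -> nat) : place K -> int :=
  fun v => if v \in A then (m v)%:Z else 0.

Lemma box_divisorP m : [/\ divisor (box_divisor m), forall v, 0 <= box_divisor m v &
  (q ^ `|deg (box_divisor m)| = \prod_(v <- A) residue_card v ^ m v)%N].
Proof.
have h v : v \notin A -> box_divisor m v = 0 by rewrite /box_divisor => /negPf ->.
split; [exact: divisor_of_fset h|by move=> v; rewrite /box_divisor; case: ifP|].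
rewrite (deg_seq h).
have -> : \sum_(v <- A) box_divisor m v * (residue_degree v)%:Z = (\sum_(v <- A) m v * residue_degree v)%N%:Z.
  rewrite -natz natr_sum; apply: eq_big_seq => v vA.
  by rewrite /box_divisor vA natz PoszM.
by rewrite absz_nat expn_sum; apply: eq_bigr => v _; rewrite /residue_card -expnM mulnC.
Qed.

Lemma rr_space_boxP m x : L (box_divisor m) x <->
  (forall v, v \in A -> (pole_order v x <= m v)%N) /\ (forall v, v \notin A -> pole_order v x = 0%N).
Proof.
split=> [hx|[h1 h2] v]; last first.
  rewrite -[(_ <= _)%E]/(vge _ _ _) /box_divisor; case: ifPn => vA.
    by rewrite -pole_order_le h1.
  by rewrite -pole_order_le h2.
have hx' v : vge v (- box_divisor m v) x by exact: hx.
split=> v vA; have := hx' v; rewrite /box_divisor.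
  by rewrite vA -pole_order_le.
by rewrite (negPf vA) -pole_order_le leqn0 => /eqP.
Qed.

Lemma prodr_indicator (I : finType) (G : I -> T) (P : pred I) :
  \prod_i (G i *+ P i) = (\prod_i G i) *+ [forall i, P i].
Proof.
have [/forallP h|/forallPn[i hi]] := boolP [forall i, P i].
  by apply: eq_bigr => i _; rewrite h.
by rewrite (bigD1 i) //= (negPf hi) mulr0n mul0r.
Qed.

(** Expanding the product of the sums of drops gives a sum, over the effective
    divisors in the box, of a product of drops times the cardinal of the
    Riemann-Roch space.  That cardinal is multiplicative up to the correction at
    the zero divisor, so both parts factor again over the places. *)
Lemma sum_over_box :
  \sum_(x <- fset_set (L (box_divisor (fun=> n)))) \prod_(v <- A) w v (pole_order v x) =
  (q ^ (1 - g))%:R * \prod_(v <- A) (\sum_(j < n.+1) weight_drop v j * (residue_card v)%:R ^+ j)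
  + (if g == 1%N then (q - 1)%:R else 0) * \prod_(v <- A) weight_drop v 0.
Proof.
have [dn n0 _] := box_divisorP (fun=> n).
have fn := finite_rr_space hg dn.
pose ext (m : {ffun A -> 'I_n.+1}) v : nat := if insub v is Some v' then m v' else 0%N.
have extE m (v : A) : ext m (val v) = m v by rewrite /ext valK.
transitivity (\sum_(m : {ffun A -> 'I_n.+1}) (\prod_(v : A) weight_drop (val v) (m v)) *
   (cardL (box_divisor (ext m)))%:R).
  transitivity (\sum_(x <- fset_set (L (box_divisor (fun=> n)))) \sum_(m : {ffun A -> 'I_n.+1})
     (\prod_(v : A) weight_drop (val v) (m v)) *+ [forall v : A, (pole_order (val v) x <= m v)%N]).
    apply: eq_big_seq => x; rewrite in_fset_set // => /set_mem /rr_space_boxP[hx _].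
    rewrite big_seq_fsetE /=.
    under eq_bigr => v _ do rewrite -(sum_weight_drop _ (hx _ (valP v))).
    rewrite bigA_distr_bigA /=; apply: eq_bigr => m _.
    exact: (prodr_indicator (fun v : A => weight_drop (val v) (m v)) (fun v : A => (pole_order (val v) x <= m v)%N)).
  rewrite exchange_big /=; apply: eq_bigr => m _.
  under eq_bigr do rewrite -mulr_natr.
  rewrite -mulr_sumr; congr (_ * _).
  rewrite -natr_sum; congr (_%:R).
  rewrite -[LHS]/(\sum_(x <- _) nat_of_bool _)%N.
  have [_ ->] : finite_set (L (box_divisor (ext m))) /\ cardL (box_divisor (ext m)) =
     size [seq x <- fset_set (L (box_divisor (fun=> n))) | [forall v : A, (pole_order (val v) x <= m v)%N]].
    apply: card_set_seq; last by rewrite filter_uniq // fset_uniq.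
    move=> x; rewrite mem_filter in_fset_set // rr_space_boxP; split.
      move=> [h1 h2]; apply/andP; split.
        by apply/forallP => v; rewrite -extE h1 // (valP v).
      apply/mem_set/rr_space_boxP; split => // v vA; rewrite (leq_trans (h1 v vA)) //.
      by rewrite -[v]/(val [` vA]%fset) extE -ltnS.
    move=> /andP[/forallP h1 /set_mem/rr_space_boxP[_ h2]]; split => // v vA.
    by have := h1 [` vA]%fset; rewrite -extE.
  by rewrite size_filter -sum1_count [RHS]big_mkcond; apply: eq_bigr => x _; case: ifP.
transitivity (\sum_(m : {ffun A -> 'I_n.+1}) ((q ^ (1 - g))%:R *
    \prod_(v : A) (weight_drop (val v) (m v) * (residue_card (val v))%:R ^+ m v) +
    (if g == 1%N then (q - 1)%:R else 0) *
    (\prod_(v : A) weight_drop (val v) (m v) *+ (m == [ffun=> ord0])))).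
  apply: eq_bigr => m _; have [dm m0 Em] := box_divisorP (ext m).
  rewrite (card_rr_space_effective dm m0) Em natrD mulrDr; congr (_ + _).
    rewrite natrM mulrCA; congr (_ * _); rewrite big_split /=; congr (_ * _).
    rewrite natr_prod big_seq_fsetE; apply: eq_bigr => v _.
    by rewrite extE natrX.
  have -> : `[< g = 1%N /\ box_divisor (ext m) = zerodiv >] = (g == 1%N) && (m == [ffun=> ord0]).
    apply/asboolP/andP => [[-> h]|[/eqP-> /eqP mE]].
      split=> //; apply/eqP/ffunP => v; apply/val_inj; rewrite ffunE /=.
      by have := congr1 (fun f => f (val v)) h; rewrite /box_divisor (valP v) extE => -[].
    split=> //; apply/funext => v; rewrite /box_divisor; case: ifP => // vA.
    by rewrite -[v]/(val [` vA]%fset) extE mE ffunE.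
  case: (g == 1%N) => /=; last by rewrite mul0n mulr0 mul0r.
  by case: (m == _) => /=; rewrite ?mulr1n ?mulr0n ?mul1n ?mul0n ?mulr0 // mulrC.
rewrite big_split /= -!mulr_sumr; congr (_ * _ + _ * _).
  rewrite [in RHS]big_seq_fsetE /= bigA_distr_bigA /=; apply: eq_bigr => m _.
  by [].
rewrite (bigD1 [ffun=> ord0]) //= eqxx mulr1n [X in _ + X]big1 ?addr0.
  by rewrite [in RHS]big_seq_fsetE /=; apply: eq_bigr => v _; rewrite ffunE.
by move=> m /negPf ->; rewrite mulr0n.
Qed.

End Box.
End BoxSums.

(** * The canonical height *)
Section CanonicalHeight.
Context (R : realType) (F : finFieldType) (K : fieldExtType {fraction {poly F}}).
Implicit Types (v w : place K) (x y z : K).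

Lemma residue_card_ge2 v : (2 <= residue_card v)%N.
Proof.
rewrite /residue_card (leq_trans (finNzRing_gt1 F)) // -[X in (X <= _)%N]expn1.
by rewrite leq_exp2l ?finNzRing_gt1 // residue_degree_gt0.
Qed.

Lemma residue_card_gt0 v : 0 < (residue_card v)%:R :> R.
Proof. by rewrite ltr0n (leq_trans _ (residue_card_ge2 v)). Qed.

Lemma max1_absv v x : Num.max 1 (absv R v x) = (residue_card v)%:R ^+ pole_order v x.
Proof.
have q0 := residue_card_gt0 v.
have q1 : 1 <= (residue_card v)%:R :> R by rewrite ler1n (leq_trans _ (residue_card_ge2 v)).
have [->|x0] := eqVneq x 0.
  by rewrite /absv val_zero /pole_order /ord val_zero expr0 max_l.
rewrite /absv val_ord // /pole_order; case: ltP => h.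
  have -> : - ord v x = `|ord v x|%N by lia.
  by rewrite -exprnP max_r // exprn_ege1.
have -> : ord v x = `|ord v x|%N by lia.
rewrite -invr_expz -exprnP expr0 max_l // invf_le1 ?exprn_gt0 //.
by rewrite exprn_ege1.
Qed.

Lemma height_fset x (A : {fset place K}) : (forall v, v \notin A -> pole_order v x = 0%N) ->
  height R x = \prod_(v <- A) (residue_card v)%:R ^+ pole_order v x.
Proof.
move=> h; rewrite /height (fsbigTE A); last by move=> v /h; rewrite max1_absv => ->; rewrite expr0.
by apply: eq_bigr => v _; rewrite max1_absv.
Qed.

Context (d : nat) (hd : (2 <= d)%N) (f : K) (f0 : f != 0).
Hypothesis hfd : forall v : place K, ord v f < d%:Z.
Let phi : {poly K} := 'X^d + (f^-1)%:P.

Definition orbit_pt x n := iter n (fun z => phi.[z]) x.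

Let phiE z : phi.[z] = z ^+ d + f^-1.
Proof. by rewrite hornerD hornerXn hornerC. Qed.

Let fV0 : f^-1 != 0. Proof. by rewrite invr_eq0. Qed.

(** At a pole of [z] the term [z ^+ d] dominates, because the order of [f] is
    smaller than [d]. *)
Lemma ord_phi_pole v z : z != 0 -> ord v z < 0 ->
  phi.[z] != 0 /\ ord v phi.[z] = ord v z * d%:Z.
Proof.
move=> z0 vz; rewrite phiE.
have e : ord v (z ^+ d) = ord v z * d%:Z by rewrite ordX // -mulr_natr natz.
have [||h1 h2] := @ordD_lt _ _ v (z ^+ d) f^-1; first by rewrite expf_neq0.
  by rewrite vge_ord // ordV // e; have := hfd v; nia.
by rewrite h2.
Qed.

Lemma ord_orbit_pole v x n : x != 0 -> ord v x < 0 ->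
  orbit_pt x n != 0 /\ ord v (orbit_pt x n) = ord v x * (d ^ n)%N%:Z.
Proof.
move=> x0 vx; elim: n => [|n [IH1 IH2]]; first by rewrite mulr1.
have [|h1 h2] := ord_phi_pole IH1 (_ : ord v (orbit_pt x n) < 0).
  by rewrite IH2; have : (0 < d ^ n)%N by [rewrite expn_gt0; lia]; nia.
by split => //; rewrite [LHS]h2 IH2 expnS; lia.
Qed.

Lemma orbit_ptSr x n : orbit_pt x n.+1 = orbit_pt phi.[x] n.
Proof. by rewrite /orbit_pt iterSr. Qed.

(** The pole order of the translation term [f^-1], hence the pole order acquired
    by the first iterate of an element that is integral at [v]. *)
Definition excess v : nat := absz (Num.max 0 (ord v f)).

(** If [x] is integral at [v] and [f] vanishes there, the first iterate has the
    pole of [f^-1]; afterwards every step multiplies the pole order by [d]. *)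
Lemma pole_orbit v x n : pole_order v (orbit_pt x n.+1) =
  (if pole_order v x == 0 then excess v * d ^ n else pole_order v x * d ^ n.+1)%N.
Proof.
have dn0 m : (0 < d ^ m)%N by rewrite expn_gt0; lia.
case: ifPn => [/eqP px|px]; last first.
  have [x0 vx] : x != 0 /\ ord v x < 0.
    move: px; rewrite /pole_order; case: ifP => // h _; split => //.
    by apply: contraTneq h => ->; rewrite /ord val_zero.
  have [_ h] := ord_orbit_pole n.+1 x0 vx.
  rewrite {1}/pole_order h /pole_order vx ifT; last by have := dn0 n.+1; nia.
  by rewrite abszM absz_nat.
have vx : vge v 0 x by rewrite -[0]oppr0 -(pole_order_le v x 0) px.
have vxd : vge v 0 (x ^+ d) by exact: vgeX.
have [vf|vf] := ltP 0 (ord v f); last first.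
  have -> : excess v = 0%N by rewrite /excess max_l.
  have vfV : vge v 0 f^-1 by rewrite vge_ord // ordV // oppr_ge0.
  apply/eqP; rewrite mul0n -leqn0 pole_order_le oppr0.
  elim: n.+1 => [//|m IH]; rewrite /orbit_pt iterS -/(orbit_pt x m) phiE.
  by apply: vgeD => //; exact: vgeX.
have [|h1 h2] := @ordD_lt _ _ v f^-1 (x ^+ d) fV0.
  by apply: vgeW vxd; rewrite ordV //; lia.
rewrite addrC -phiE in h1 h2; rewrite ordV // in h2.
have [|_ h] := ord_orbit_pole n h1 (_ : ord v phi.[x] < 0); first by rewrite h2; lia.
rewrite orbit_ptSr /pole_order h h2 ifT; last by have := dn0 n; nia.
by rewrite abszM absz_nat abszN /excess max_r // ltW.
Qed.

Definition local_exponent v x : R :=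
  if pole_order v x == 0%N then (excess v)%:R / d%:R else (pole_order v x)%:R.

(** The sequence defining the canonical height is constant from the index 1 on. *)
Lemma canonical_heightE x (A : {fset place K}) :
  (forall v, v \notin A -> pole_order v x = 0%N /\ excess v = 0%N) ->
  canonical_height R phi x = \prod_(v <- A) (residue_card v)%:R `^ local_exponent v x.
Proof.
move=> hA.
have dR0 : d%:R != 0 :> R by rewrite pnatr_eq0; lia.
apply: cvg_lim => //; apply: cvg_near_cst; exists 1%N => // -[//|n] _.
change (height R (orbit_pt x n.+1) `^ (((size phi).-1 ^ n.+1)%N%:R^-1) =
  \prod_(v <- A) (residue_card v)%:R `^ local_exponent v x).
rewrite (@height_fset _ A); last first.
  by move=> v /hA[h1 h2]; rewrite pole_orbit h1 h2.
have -> : (size phi).-1 = d.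
  rewrite /phi size_polyDl ?size_polyXn // size_polyC fV0; lia.
have prodpow (s : seq (place K)) (G : place K -> R) r : (forall v, 0 <= G v) ->
   (\prod_(v <- s) G v) `^ r = \prod_(v <- s) (G v) `^ r.
  move=> G0; elim: s => [|v s IH]; first by rewrite !big_nil powR1.
  by rewrite !big_cons powRM ?IH // prodr_ge0.
rewrite prodpow => [|v]; last by rewrite exprn_ge0.
apply: eq_bigr => v _; rewrite -powR_mulrn // -powRrM; congr (_ `^ _).
rewrite pole_orbit /local_exponent; case: ifP => _; rewrite natrM.
  by rewrite expnS natrM invfM [_^-1 * _]mulrC mulrA mulfK // pnatr_eq0 expn_eq0; lia.
by rewrite mulfK // pnatr_eq0 expn_eq0; lia.
Qed.

End CanonicalHeight.
(** * Limits along finite sets *)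
Import Normc.
#[local] Instance totally_proper (I : choiceType) : ProperFilter (@totally I) := @summability.totally_filter I.

Section ComplexNets.
Context (R : realType).
Local Notation C := (R[i]^o).

Lemma normrE (z : R[i]) : `|z| = (normc z)%:C%C.
Proof. by []. Qed.

Lemma normc_ge0 (z : R[i]) : 0 <= normc z.
Proof. by case: z => a b; exact: sqrtr_ge0. Qed.

Lemma normc_le (z : R[i]) : normc z <= `|complex.Re z| + `|complex.Im z|.
Proof.
rewrite {1}(complexE z) (le_trans (le_normcD _ _)) // normcM.
have h (a : R) : normc (a%:C)%C = `|a| by rewrite /= expr0n /= addr0 sqrtr_sqr.
by rewrite !h /= expr0n expr1n add0r sqrtr1 mul1r.
Qed.

Lemma normc_geRe (z : R[i]) : `|complex.Re z| <= normc z.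
Proof. by have := normc_ge_Re z; rewrite normrE lecR. Qed.

Lemma normc_geIm (z : R[i]) : `|complex.Im z| <= normc z.
Proof.
case: z => a b /=; rewrite -(sqrtr_sqr b); apply: ler_wsqrtr.
by rewrite lerDr sqr_ge0.
Qed.

Lemma cvg_totallyP (I : choiceType) (phi : {fset I} -> C) (l : C) :
  phi @ totally --> l <-> forall e : R, 0 < e ->
    exists A0 : {fset I}, forall A, (A0 `<=` A)%fset -> normc (l - phi A) < e.
Proof.
split=> [/cvgrPdist_lt h e e0|h].
  have [|A0 _ hA0] := h (e%:C%C); first by rewrite ltcR.
  by exists A0 => A /hA0; rewrite /= normrE ltcR.
apply/cvgrPdist_lt => e; rewrite ltcE => /andP[/eqP ime ree].
have [A0 hA0] := h _ ree; exists A0 => // A /= /hA0 h'.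
by rewrite normrE ltcE /= ime eqxx h'.
Qed.

Lemma cvg_natP (u : nat -> C) (l : C) :
  u @ \oo --> l <-> forall e : R, 0 < e -> exists N, forall n, (N <= n)%N -> normc (l - u n) < e.
Proof.
split=> [/cvgrPdist_lt h e e0|h].
  have [|A0 _ hA0] := h (e%:C%C); first by rewrite ltcR.
  by exists A0 => A /hA0; rewrite /= normrE ltcR.
apply/cvgrPdist_lt => e; rewrite ltcE => /andP[/eqP ime ree].
have [A0 hA0] := h _ ree; exists A0 => // A /= /hA0 h'.
by rewrite normrE ltcE /= ime eqxx h'.
Qed.

Lemma cvgC_unique (T : Type) (G : set_system T) (FG : ProperFilter G) (u : T -> C) (l l' : C) :
  u @ G --> l -> u @ G --> l' -> l = l'.
Proof. exact: (cvg_unique (@norm_hausdorff _ C)). Qed.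

Lemma cvgC_mul (T : Type) (G : set_system T) (FG : ProperFilter G) (u w : T -> C) (l k : C) :
  u @ G --> l -> w @ G --> k -> (fun x => u x * w x : C) @ G --> (l * k : C).
Proof. by move=> h1 h2; exact: (@cvgM R[i] T G FG u w l k h1 h2). Qed.

Lemma cvgC_add (T : Type) (G : set_system T) (FG : ProperFilter G) (u w : T -> C) (l k : C) :
  u @ G --> l -> w @ G --> k -> (fun x => u x + w x : C) @ G --> (l + k : C).
Proof. by move=> h1 h2; exact: (@cvgD _ _ _ _ _ u w l k h1 h2). Qed.

Lemma cvgC_cst (T : Type) (G : set_system T) (FG : ProperFilter G) (l : C) :
  (fun=> l : C) @ G --> l.
Proof. exact: cvg_cst. Qed.

Lemma monotone_net (I : choiceType) (h : {fset I} -> R) (M : R) :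
  (forall A B, (A `<=` B)%fset -> h A <= h B) -> (forall A, h A <= M) ->
  exists l, forall e, 0 < e -> exists A0, forall A, (A0 `<=` A)%fset -> `|l - h A| < e.
Proof.
move=> mono bd; have hs : has_sup (range h).
  by split; [exists (h fset0), fset0|exists M => _ [A _ <-]].
exists (sup (range h)) => e e0.
have [_ [A0 _ <-] hA0] := sup_adherent e0 hs; exists A0 => A A0A.
have hA : h A <= sup (range h) by apply: sup_upper_bound => //; exists A.
by rewrite ger0_norm ?subr_ge0 //; have := mono _ _ A0A; lra.
Qed.

(** Both [h] and [phi + h] are monotone and bounded, so [phi] converges without
    an appeal to Cauchy filters. *)
Lemma dominated_real_net (I : choiceType) (phi h : {fset I} -> R) (M : R) :
  (forall A B, (A `<=` B)%fset -> `|phi B - phi A| <= h B - h A) -> (forall A, h A <= M) ->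
  exists l, forall e, 0 < e -> exists A0, forall A, (A0 `<=` A)%fset -> `|l - phi A| < e.
Proof.
move=> dom bd.
have mono A B : (A `<=` B)%fset -> h A <= h B.
  by move=> /dom; have := normr_ge0 (phi B - phi A); lra.
have [l hl] := monotone_net mono bd.
have [||k hk] := @monotone_net I (fun A => phi A + h A) (phi fset0 - h fset0 + 2 * M).
- by move=> A B /dom; rewrite ler_norml => /andP[]; lra.
- move=> A; have := dom _ _ (fsub0set A); rewrite ler_norml => /andP[_].
  by have := bd A; lra.
exists (k - l) => e e0; have e20 : 0 < e / 2 by lra.
have [A1 h1] := hl _ e20; have [A2 h2] := hk _ e20.
exists (A1 `|` A2)%fset => A; rewrite fsubUset => /andP[/h1 a1 /h2 a2].
have -> : k - l - phi A = (k - (phi A + h A)) - (l - h A) by ring.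
by rewrite (le_lt_trans (ler_normB _ _)) // (splitr e) ltrD.
Qed.

(** The criterion used both for unconditional sums, with [h] the sum of the
    norms, and for unconditional products, with [h] the product of the
    [1 + normc (b i)]. *)
Lemma dominated_net (I : choiceType) (phi : {fset I} -> C) (h : {fset I} -> R) (M : R) :
  (forall A B, (A `<=` B)%fset -> normc (phi B - phi A) <= h B - h A) -> (forall A, h A <= M) ->
  exists l : C, phi @ totally --> l.
Proof.
move=> dom bd.
have [|a ha] := @dominated_real_net I (fun A => complex.Re (phi A)) h M _ bd.
  by move=> A B /dom; apply: le_trans; have := normc_geRe (phi B - phi A); rewrite raddfB.
have [|b hb] := @dominated_real_net I (fun A => complex.Im (phi A)) h M _ bd.
  by move=> A B /dom; apply: le_trans; have := normc_geIm (phi B - phi A); rewrite raddfB.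
exists (Complex a b); apply/cvg_totallyP => e e0; have e20 : 0 < e / 2 by lra.
have [A1 h1] := ha _ e20; have [A2 h2] := hb _ e20.
exists (A1 `|` A2)%fset => A; rewrite fsubUset => /andP[/h1 a1 /h2 a2].
rewrite (le_lt_trans (normc_le _)) // (splitr e).
by move: a1 a2; case: (phi A) => x y /= a1 a2; rewrite ltrD.
Qed.

End ComplexNets.

Section Products.
Context (R : realType) (I : choiceType).
Local Notation C := (R[i]^o).
Implicit Types (A B : {fset I}).

Lemma big_fset_sub (T : Type) (idx : T) (op : Monoid.com_law idx) (G : I -> T) A B :
  (A `<=` B)%fset ->
  \big[op/idx]_(i <- B) G i = op (\big[op/idx]_(i <- A) G i) (\big[op/idx]_(i <- (B `\` A)%fset) G i).
Proof.
move=> /fsubsetP AB; rewrite -big_cat; apply: perm_big; apply: uniq_perm.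
- exact: fset_uniq.
- rewrite cat_uniq !fset_uniq andbT /=; apply/hasPn => i.
  by rewrite inE => /andP[].
- move=> i; rewrite mem_cat inE; case: (boolP (i \in A)) => [/AB -> //|_] //=.
Qed.

Lemma prod1D_le (x : I -> R) A : (forall i, 0 <= x i) ->
  \prod_(i <- A) (1 + x i) <= expR (\sum_(i <- A) x i).
Proof.
move=> x0; rewrite expR_sum; apply: ler_prod => i _.
by rewrite addr_ge0 //= expR_ge1Dx.
Qed.

Lemma normc_prod1D (b : I -> R[i]) (s : seq I) :
  normc (\prod_(i <- s) (1 + b i) - 1) <= \prod_(i <- s) (1 + normc (b i)) - 1 /\
  normc (\prod_(i <- s) (1 + b i)) <= \prod_(i <- s) (1 + normc (b i)).
Proof.
elim: s => [|i s [IH1 IH2]]; first by rewrite !big_nil !subrr normc0 normc1.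
rewrite !big_cons; split.
  have -> : (1 + b i) * \prod_(j <- s) (1 + b j) - 1 =
      (\prod_(j <- s) (1 + b j) - 1) + b i * \prod_(j <- s) (1 + b j) by ring.
  rewrite (le_trans (le_normcD _ _)) // normcM.
  have := ler_wpM2l (normc_ge0 (b i)) IH2; lra.
rewrite normcM ler_pM ?normc_ge0 //.
by rewrite (le_trans (le_normcD _ _)) // normc1.
Qed.

Lemma cvg_prod1D (b : I -> R[i]) (M : R) : (forall A, \sum_(i <- A) normc (b i) <= M) ->
  exists l : C, (fun A : {fset I} => \prod_(i <- A) (1 + b i) : C) @ totally --> l.
Proof.
move=> bM; apply: (@dominated_net _ _ _ (fun A => \prod_(i <- A) (1 + normc (b i))) (expR M)).
  move=> A B AB; rewrite !(big_fset_sub _ _ AB) /=.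
  rewrite -[X in normc (_ - X)]mulr1 -mulrBr normcM -[X in _ <= _ - X]mulr1 -mulrBr.
  have [h1 h2] := normc_prod1D b (B `\` A)%fset.
  by apply: ler_pM; rewrite ?normc_ge0 //; case: (normc_prod1D b A).
move=> A; apply: le_trans (prod1D_le _ _) _ => [i|]; first exact: normc_ge0.
by rewrite ler_expR.
Qed.

(** The product and the product of the inverses both converge, and their limits
    are inverse to each other; hence neither vanishes. *)
Lemma euler_product (a : I -> R[i]) (M : R) :
  (forall i, normc (a i) <= 2^-1) -> (forall A, \sum_(i <- A) normc (a i) <= M) ->
  exists l : C, [/\ l != 0,
    (fun A : {fset I} => \prod_(i <- A) (1 - a i)^-1 : C) @ totally --> l &
    (fun A : {fset I} => \prod_(i <- A) (1 - a i) : C) @ totally --> l^-1].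
Proof.
move=> a2 aM.
have n1 i : 2^-1 <= normc (1 - a i).
  have := le_normcD (1 - a i) (a i); rewrite subrK normc1; have := a2 i; lra.
have a1 i : 1 - a i != 0 by apply/eqP => h; have := n1 i; rewrite h normc0; lra.
have [|l1 h1] := @cvg_prod1D (fun i => - a i) M.
  by move=> A; under eq_bigr do rewrite normcN.
have [|l2 h2] := @cvg_prod1D (fun i => a i / (1 - a i)) (2 * M).
  move=> A; apply: (@le_trans _ _ (\sum_(i <- A) 2 * normc (a i))).
    apply: ler_sum => i _; rewrite normcM normcV mulrC; apply: ler_wpM2r; first exact: normc_ge0.
    have np : 0 < normc (1 - a i) by have := n1 i; lra.
    by rewrite -[leRHS]invrK lef_pV2 ?posrE ?n1 ?invr_gt0.
  by rewrite -mulr_sumr ler_wpM2l.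
have E2 : (fun A : {fset I} => \prod_(i <- A) (1 + a i / (1 - a i)) : C) =
          (fun A : {fset I} => \prod_(i <- A) (1 - a i)^-1 : C).
  apply/funext => A; apply: eq_bigr => i _.
  by field; exact: a1.
rewrite E2 in h2.
have l12 : l1 * l2 = 1.
  have h := cvgC_mul (totally_proper I) h1 h2; apply: (cvgC_unique (totally_proper I) h).
  rewrite (_ : (fun A : {fset I} => _) = fun=> 1 : C); first exact: (cvgC_cst (totally_proper I)).
  apply/funext => A; rewrite -big_split /= big1 // => i _.
  by rewrite divff.
have l20 : l2 != 0 by apply: contra_eqN l12 => /eqP ->; rewrite mulr0 eq_sym oner_eq0.
have l1E : l2^-1 = l1 by apply: (mulIf l20); rewrite mulVf.
by exists l2; rewrite l1E; split; [exact: l20|exact: h2|exact: h1].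
Qed.

Lemma cvg_partial_sum (x : I -> C) (M : R) : (forall A, \sum_(i <- A) normc (x i) <= M) ->
  exists l : C, partial_sum x @ totally --> l.
Proof.
move=> xM; apply: (@dominated_net _ _ _ (fun A => \sum_(i <- A) normc (x i)) M) => // A B AB.
have E A' : partial_sum x A' = \sum_(i <- A') x i by rewrite big_seq_fsetE.
rewrite !E !(big_fset_sub _ _ AB) /= [X in normc X]addrC addKr [leRHS]addrC addKr.
elim: (enum_fset _) => [|i s IH]; first by rewrite !big_nil normc0.
by rewrite !big_cons (le_trans (le_normcD _ _)) // lerD2l.
Qed.

End Products.

(** * Complex powers and the convergence of Euler products *)
Section ComplexPowers.
Context (R : realType).
Implicit Types (a b r : R) (s t : R[i]).

Lemma cpowM a b s : 0 < a -> 0 < b -> cpow (a * b) s = cpow a s * cpow b s.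
Proof.
move=> a0 b0; rewrite /cpow powRM ?ltW // lnM ?posrE // mulrDr cosD sinD.
by apply/eqP; rewrite eq_complex /=; apply/andP; split; apply/eqP; ring.
Qed.

Lemma cpowD a s t : 0 < a -> cpow a (s + t) = cpow a s * cpow a t.
Proof.
move=> a0; rewrite /cpow !raddfD powRD; last by rewrite (gt_eqF a0) implybT.
rewrite mulrDl cosD sinD.
by apply/eqP; rewrite eq_complex /=; apply/andP; split; apply/eqP; ring.
Qed.

Lemma cpow0 a : cpow a 0 = 1.
Proof. by rewrite /cpow /= powRr0 mul0r cos0 sin0 mulr1. Qed.

Lemma cpow1 s : cpow (1 : R) s = 1.
Proof. by rewrite /cpow /= powR1 ln1 mulr0 cos0 sin0 mulr1. Qed.

Lemma cpow_powR a r s : 0 < a -> cpow (a `^ r) s = cpow a ((r%:C)%C * s).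
Proof.
move=> a0; case: s => s1 s2; rewrite /cpow /= ln_powR !mul0r subr0 addr0.
by rewrite -powRrM; congr (_ * Complex (cos _) (sin _)); ring.
Qed.

Lemma cpow_nat a s n : 0 < a -> cpow a (n%:R * s) = cpow a s ^+ n.
Proof.
move=> a0; elim: n => [|n IH]; first by rewrite mul0r cpow0 expr0.
by rewrite mulrS mulrDl mul1r cpowD // IH exprS.
Qed.

Lemma cpowX a s n : 0 < a -> cpow (a ^+ n) s = cpow a s ^+ n.
Proof.
move=> a0; elim: n => [|n IH]; first by rewrite !expr0 cpow1.
by rewrite !exprS cpowM ?exprn_gt0 // IH.
Qed.

Lemma normc_cpow a s : 0 < a -> normc (cpow a s) = a `^ (complex.Re s).
Proof.
move=> a0; rewrite /cpow normcM /= expr0n /= addr0 sqrtr_sqr ger0_norm ?powR_ge0 //.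
by rewrite cos2Dsin2 sqrtr1 mulr1.
Qed.

Lemma cpow_neq0 a s : 0 < a -> cpow a s != 0.
Proof.
by move=> a0; apply/eqP => h; have := normc_cpow s a0; rewrite h normc0 => /esym/eqP; rewrite gt_eqF // powR_gt0.
Qed.

End ComplexPowers.

Section PlaceSum.
Context (R : realType) (F : finFieldType) (K : fieldExtType {fraction {poly F}}).
Context (hK : full_constant_field K) (g : nat) (hg : is_genus K g).

(** Group the places by degree: there are at most [c q ^ n] of degree [n], which
    leaves a convergent geometric series. *)
Lemma sum_residue_card (tau : R) : 1 < tau ->
  exists M, forall A : {fset place K}, \sum_(v <- A) (residue_card v)%:R `^ (- tau) <= M.
Proof.
move=> tau1; have [c hc] := count_places hK hg.
have q1 : 1 < #|F|%:R :> R by rewrite ltr1n finNzRing_gt1.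
have q0 : 0 < #|F|%:R :> R by apply: lt_trans q1.
set x := #|F|%:R `^ (- tau); set r := #|F|%:R * x.
have x0 : 0 <= x by exact: powR_ge0.
have r1 : r < 1.
  rewrite /r -[X in X * _](powRr1 (ltW q0)) -powRD; last by rewrite (gt_eqF q0) implybT.
  rewrite lt_neqAle powR_eq1 !negb_or (gt_eqF q1) -leNgt (ltW q0) lt_eqF /=; last by lra.
  by rewrite -[leRHS](powRr0 #|F|%:R) ler_powR ?(ltW q1) //; lra.
have r0 : 0 <= r by rewrite mulr_ge0 // ltW.
have vE (v : place K) : (residue_card v)%:R `^ (- tau) = x ^+ residue_degree v.
  by rewrite /residue_card natrX -powR_mulrn ?ltW // -powRrM mulrC powRrM powR_mulrn.
exists (c%:R / (1 - r)) => A.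
under eq_bigr do rewrite vE.
pose N := \max_(v <- A) residue_degree v.
rewrite (partition_big (fun v => inord (residue_degree v) : 'I_N.+1) xpredT) //=.
apply: (@le_trans _ _ (\sum_(n < N.+1) c%:R * r ^+ n)).
  apply: ler_sum => n _.
  have degN v : v \in A -> residue_degree v = (inord (residue_degree v) : 'I_N.+1).
    by move=> vA; rewrite inordK // ltnS /N (big_rem v) //= leq_maxl.
  pose B := [fset v in A | (inord (residue_degree v) : 'I_N.+1) == n]%fset.
  have BP v : v \in B -> residue_degree v = n by rewrite !inE => /andP[vA /eqP <-]; exact: degN.
  rewrite -big_filter (perm_big B) /=; last first.
    by apply: uniq_perm; rewrite ?filter_uniq ?fset_uniq // => v; rewrite mem_filter !inE andbC.
  rewrite big_seq; under eq_bigr => v vB do rewrite (BP v vB).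
  rewrite -big_seq big_const_seq count_predT iter_addr_0 -[leLHS]mulr_natr.
  rewrite /r exprMn mulrA [leLHS]mulrC; apply: ler_wpM2r; first exact: exprn_ge0.
  by rewrite -natrX -natrM ler_nat; exact: hc.
rewrite -mulr_sumr ler_wpM2l //.
have rp : 0 < 1 - r by rewrite subr_gt0.
have e : (\sum_(i < N.+1) r ^+ i) * (1 - r) = 1 - r ^+ N.+1.
  by transitivity (- (r ^+ N.+1 - 1)); [rewrite subrX1; ring|rewrite opprB].
by rewrite -[leRHS]mul1r ler_pdivlMr // e gerBl exprn_ge0.
Qed.

End PlaceSum.

(** * Passage to the limit over boxes *)

(** The local factor of a box for a weight that is geometric except at 0. *)
Lemma local_box_sum (T : fieldType) (a b Q : T) (w : nat -> T) n : 1 - a * Q != 0 ->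
  w 0%N = b -> (forall j, w j.+1 = a ^+ j.+1) ->
  \sum_(j < n.+2) (if (j < n.+1)%N then w j - w j.+1 else w j) * Q ^+ j =
  b - a + (1 - a) * ((a * Q - (a * Q) ^+ n.+1) / (1 - a * Q)) + (a * Q) ^+ n.+1.
Proof.
move=> h w0 wS; rewrite big_ord_recr /= ltnn wS -exprMn; congr (_ + _).
rewrite big_ord_recl /= w0 wS expr0 expr1 mulr1; congr (_ + _).
transitivity ((1 - a) * ((a * Q) * \sum_(j < n) (a * Q) ^+ j)).
  rewrite !mulr_sumr; apply: eq_bigr => j _.
  by rewrite /bump leq0n add1n ltnS ltn_ord !wS -exprS !exprMn !exprS; ring.
move: (a * Q) h => r h; congr (_ * _); apply: (mulIf h); rewrite divfK // -mulrA.
have -> : (\sum_(j < n) r ^+ j) * (1 - r) = 1 - r ^+ n.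
  by transitivity (- (r ^+ n - 1)); [rewrite subrX1; ring|rewrite opprB].
by rewrite exprS mulrBr mulr1.
Qed.

Lemma expr_lt_eps (R : realType) (x e : R) : 0 <= x -> x < 1 -> 0 < e ->
  exists N, forall n, (N <= n)%N -> x ^+ n < e.
Proof.
move=> x0 x1 e0.
have /cvgrPdist_lt/(_ e e0)[N _ hN] : (GRing.exp x : R ^nat) @ \oo --> 0.
  by apply: cvg_expr; rewrite ger0_norm.
by exists N => n /hN /=; rewrite sub0r normrN ger0_norm // exprn_ge0.
Qed.

Lemma normc_prod (R : realType) (I : Type) (s : seq I) (G : I -> R[i]) :
  normc (\prod_(i <- s) G i) = \prod_(i <- s) normc (G i).
Proof.
elim: s => [|i s IH]; first by rewrite !big_nil normc1.
by rewrite !big_cons normcM IH.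
Qed.

Lemma normcX (R : realType) (z : R[i]) n : normc (z ^+ n) = normc z ^+ n.
Proof. by elim: n => [|n IH]; rewrite ?expr0 ?normc1 // !exprS normcM IH. Qed.

Lemma normc_nat (R : realType) n : normc (n%:R : R[i]) = n%:R.
Proof. by rewrite -(rmorph_nat (real_complex R)) /= expr0n /= addr0 sqrtr_sqr ger0_norm. Qed.

Section Boxes.
Context (F : finFieldType) (K : fieldExtType {fraction {poly F}}).
Implicit Types (v : place K) (x : K) (A : {fset place K}).
Local Notation L := riemann_roch_space.

Definition box A n : set K := L (box_divisor A (fun=> n)).

Lemma box_mono A B m n : (A `<=` B)%fset -> (m <= n)%N -> box A m `<=` box B n.
Proof.
move=> /fsubsetP AB mn; apply: rr_space_le => v; rewrite /box_divisor.
by case: ifP => [/AB ->|_]; [|case: ifP].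
Qed.

Lemma poles_finite x : exists A, forall v, v \notin A -> pole_order v x = 0%N.
Proof.
have [->|x0] := eqVneq x 0.
  by exists fset0 => v _; rewrite /pole_order /ord val_zero.
have [A hA] := divisor_fset (divisor_div x0); exists A => v /hA.
by rewrite /div_of /pole_order => ->.
Qed.

(** The boxes are cofinal among the finite subsets of [K]. *)
Lemma exists_box (S : {fset place K}) (X : seq K) :
  exists A n, (S `<=` A)%fset /\ forall x, x \in X -> box A n x.
Proof.
elim: X => [|x X [A [n [SA hA]]]]; first by exists S, 0%N; rewrite fsubset_refl.
have [B hB] := poles_finite x.
exists (A `|` B)%fset, (maxn n (\max_(v <- B) pole_order v x)); split.
  by apply: fsubset_trans SA _; exact: fsubsetUl.
move=> y; rewrite inE => /predU1P[->|/hA]; last first.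
  by apply: box_mono; [exact: fsubsetUl|rewrite leq_maxl].
apply/rr_space_boxP; split=> v; last by rewrite inE negb_or => /andP[_ /hB].
have [vB _|/hB -> //] := boolP (v \in B).
by rewrite leq_max; apply/orP; right; rewrite (big_rem v) //= leq_maxl.
Qed.

End Boxes.

Section Assembly.
Context (R : realType) (F : finFieldType) (K : fieldExtType {fraction {poly F}}).
Implicit Types (v : place K) (x : K) (A : {fset place K}).
Context (hK : full_constant_field K) (g : nat) (hg : is_genus K g).
Context (hg01 : g = 0%N \/ g = 1%N).
Context (a b : place K -> R[i]) (S : {fset place K}) (h : K -> R[i]^o).
Local Notation C := (R[i]^o).
Local Notation Q v := (residue_card v)%:R.

Let w v j : R[i] := if j is 0%N then b v else a v ^+ j.
Let rho v : R[i] := a v * Q v.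
Hypothesis ab : forall v, normc (a v) <= normc (b v).
Hypothesis b1 : forall v, normc (b v) <= 1.
Hypothesis rho_half : forall v, normc (rho v) <= 2^-1.
Hypothesis hE : forall x A, (S `<=` A)%fset ->
  (forall v, v \notin A -> pole_order v x = 0%N) -> h x = \prod_(v <- A) w v (pole_order v x).

Let q1g (T : comNzRingType) : T := (#|F| ^ (1 - g))%:R.
Let cg (T : comNzRingType) : T := if g == 1%N then (#|F| - 1)%:R else 0.

Let E v : R[i] := b v - a v + (1 - a v) * (rho v / (1 - rho v)).

Lemma rho_neq1 v : 1 - rho v != 0.
Proof.
apply/eqP => e; have := rho_half v; have := le_normcD (1 - rho v) (rho v).
by rewrite subrK normc1 e normc0; lra.
Qed.

Definition euler_sum A : C :=
  q1g R[i] * \prod_(v <- A) E v + cg R[i] * \prod_(v <- A) (b v - a v).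

Lemma finite_box A n : finite_set (box A n).
Proof. by apply: (finite_rr_space hg); have [] := box_divisorP A (fun=> n). Qed.

Lemma box_sum A n : (S `<=` A)%fset ->
  \sum_(x <- fset_set (box A n.+1)) h x =
  q1g R[i] * \prod_(v <- A) (E v + rho v ^+ n.+1 * ((a v - rho v) / (1 - rho v)))
  + cg R[i] * \prod_(v <- A) (b v - a v).
Proof.
move=> SA; transitivity (\sum_(x <- fset_set (box A n.+1)) \prod_(v <- A) w v (pole_order v x)).
  apply: eq_big_seq => x; rewrite in_fset_set; last exact: finite_box.
  by move=> /set_mem/rr_space_boxP[_ hx]; exact: hE.
rewrite (sum_over_box hK hg hg01); congr (_ * _ + _ * _); apply: eq_bigr => v _.
  rewrite /weight_drop (@local_box_sum _ (a v) (b v) (Q v) (w v) n (rho_neq1 v)) // /E /rho.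
  by field; exact: rho_neq1.
Qed.

Lemma cvg_box_sum A : (S `<=` A)%fset ->
  (fun n => \sum_(x <- fset_set (box A n.+1)) h x : C) @ \oo --> euler_sum A.
Proof.
move=> SA; under eq_fun do rewrite box_sum //.
have FN : ProperFilter (\oo : set_system nat) by exact: eventually_filter.
apply: (cvgC_add FN); last exact: (cvgC_cst FN).
apply: (cvgC_mul FN); first exact: (cvgC_cst FN).
elim: (enum_fset A) => [|v r IH].
  by under eq_fun do rewrite big_nil; rewrite big_nil; exact: (cvgC_cst FN).
under eq_fun do rewrite big_cons.
rewrite big_cons; apply: (cvgC_mul FN); last exact: IH.
rewrite -[X in _ --> X]addr0; apply: (cvgC_add FN); first exact: (cvgC_cst FN).
rewrite -[X in _ --> X](mul0r ((a v - rho v) / (1 - rho v))).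
apply: (cvgC_mul FN); last exact: (cvgC_cst FN).
apply/cvg_natP => e e0.
have [||N hN] := @expr_lt_eps _ (normc (rho v)) e _ _ e0.
- exact: normc_ge0.
- by have := rho_half v; lra.
exists N => n Nn; rewrite sub0r normcN normcX; apply: hN; exact: leqW.
Qed.

Context (M : R) (rhoM : forall A, \sum_(v <- A) normc (rho v) <= M).

(** The norms of the weights are weights of the same shape, so the box sums of
    the norms are again products, with local factors at most
    [1 + 3 * normc (rho v)]. *)
Lemma sum_normc_bounded X : \sum_(x <- enum_fset X) normc (h x) <= q1g R * expR (3 * M) + cg R.
Proof.
have [A [n [SA hA]]] := exists_box S (enum_fset X).
have hA' x : x \in X -> box A n.+1 x.
  by move=> /hA; apply: box_mono => //; exact: fsubset_refl.
have XB : (X `<=` fset_set (box A n.+1))%fset.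
  apply/fsubsetP => x /hA' xb; rewrite in_fset_set; last exact: finite_box.
  exact: mem_set.
apply: (@le_trans _ _ (\sum_(x <- fset_set (box A n.+1)) normc (h x))).
  rewrite (big_fset_sub _ _ XB) /= lerDl; apply: sumr_ge0 => x _; exact: normc_ge0.
pose w' v j : R := if j is 0%N then normc (b v) else normc (a v) ^+ j.
pose r v : R := normc (a v) * Q v.
have rE v : r v = normc (rho v) by rewrite /rho normcM normc_nat.
have r0 v : 0 <= r v by rewrite rE normc_ge0.
have r2 v : r v <= 2^-1 by rewrite rE.
have r1 v : 1 - r v != 0 by rewrite subr_eq0 eq_sym lt_eqF //; have := r2 v; lra.
have -> : \sum_(x <- fset_set (box A n.+1)) normc (h x) =
    \sum_(x <- fset_set (box A n.+1)) \prod_(v <- A) w' v (pole_order v x).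
  apply: eq_big_seq => x; rewrite in_fset_set; last exact: finite_box.
  move=> /set_mem/rr_space_boxP[_ hx]; rewrite (hE SA hx) normc_prod; apply: eq_bigr => v _.
  by rewrite /w /w'; case: (pole_order v x) => // j; rewrite normcX.
rewrite (sum_over_box hK hg hg01).
have a0 v : 0 <= normc (a v) by exact: normc_ge0.
apply: lerD.
  apply: ler_wpM2l; first exact: ler0n.
  apply: le_trans (_ : \prod_(v <- A) (1 + 3 * normc (rho v)) <= _); last first.
    apply: le_trans (prod1D_le _ _) _ => [v|]; first by rewrite mulr_ge0 ?normc_ge0.
    by rewrite ler_expR -mulr_sumr ler_wpM2l.
  apply: ler_prod => v _.
  rewrite /weight_drop (@local_box_sum _ (normc (a v)) (normc (b v)) (Q v) (w' v) n (r1 v)) // -/(r v) -rE.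
  have av1 : normc (a v) <= 1 by exact: le_trans (ab v) (b1 v).
  have rn0 : 0 <= r v ^+ n.+1 by rewrite exprn_ge0.
  have rn : r v ^+ n.+1 <= r v.
    by rewrite -[leRHS]expr1 ler_wiXn2l //; have := r2 v; lra.
  have qt0 : 0 <= (r v - r v ^+ n.+1) / (1 - r v).
    by apply: divr_ge0; [rewrite subr_ge0|have := r2 v; lra].
  have qt : (r v - r v ^+ n.+1) / (1 - r v) <= 2 * r v.
    rewrite ler_pdivrMr; last by have := r2 v; lra.
    have := r2 v; have := r0 v; nra.
  by apply/andP; split; move: (ab v) (b1 v) (a0 v) (r0 v) => ? ? ? ?; nra.
rewrite -[leRHS]mulr1; apply: ler_wpM2l; first by rewrite /cg; case: ifP => // _; exact: ler0n.
apply: (@le_trans _ _ (\prod_(v <- A) (1 : R))); last by rewrite big1_eq.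
apply: ler_prod => v _.
by rewrite /weight_drop /= expr1; apply/andP; split; move: (ab v) (b1 v) (a0 v); lra.
Qed.

(** The two limits agree: boxes over a fixed set [A] of places exhaust it as the
    bound grows, and for large [A] and large bound they contain any prescribed
    finite subset of [K]. *)
Lemma cvg_euler_sum : exists Z : C,
  partial_sum h @ totally --> Z /\ euler_sum @ totally --> Z.
Proof.
have [Z hZ] := cvg_partial_sum sum_normc_bounded; exists Z; split => //.
apply/cvg_totallyP => e e0; have e20 : 0 < e / 2 by lra.
have [X0 hX0] := (proj1 (cvg_totallyP _ _) hZ) _ e20.
have [A0 [n0 [SA0 hA0]]] := exists_box S (enum_fset X0).
exists A0 => A A0A; have SA := fsubset_trans SA0 A0A.
have [N hN] := (proj1 (cvg_natP _ _) (cvg_box_sum SA)) _ e20.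
pose n := maxn N n0.
have XB : (X0 `<=` fset_set (box A n.+1))%fset.
  apply/fsubsetP => x /hA0 xb; rewrite in_fset_set; last exact: finite_box.
  by apply/mem_set; apply: box_mono xb => //; rewrite leqW // leq_maxr.
have h1 := hX0 _ XB; have h2 := hN n (leq_maxl _ _).
rewrite /partial_sum -(big_seq_fsetE _ _ predT) /= in h1.
set P := \sum_(x <- _) h x in h1 h2.
have -> : Z - euler_sum A = (Z - P) - (euler_sum A - P) by ring.
rewrite (le_lt_trans (le_normcD _ _)) // normcN (splitr e); exact: ltrD.
Qed.

End Assembly.

(** * Local factors of the zeta function *)
Lemma cvg_totally_eq (R : realType) (I : choiceType) (S : {fset I}) (u w : {fset I} -> R[i]^o)
    (l : R[i]^o) :
  (forall A, (S `<=` A)%fset -> u A = w A) -> u @ totally --> l -> w @ totally --> l.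
Proof.
move=> uw /cvg_totallyP hu; apply/cvg_totallyP => e /hu[A0 hA0].
exists (A0 `|` S)%fset => A; rewrite fsubUset => /andP[/hA0 + SA].
by rewrite uw.
Qed.

Lemma cpow_prod (R : realType) (I : Type) (r : seq I) (x : I -> R) (s : R[i]) :
  (forall i, 0 < x i) -> cpow (\prod_(i <- r) x i) s = \prod_(i <- r) cpow (x i) s.
Proof.
move=> x0; elim: r => [|i r IH]; first by rewrite !big_nil cpow1.
by rewrite !big_cons cpowM ?IH // prodr_gt0.
Qed.

Section LocalFactors.
Context (R : realType) (F : finFieldType) (K : fieldExtType {fraction {poly F}}).
Context (d : nat) (hd : (2 <= d)%N) (f : K).
Hypothesis hfd : forall v : place K, ord v f < d%:Z.
Context (s : R[i]) (hs : 2 < complex.Re s).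
Implicit Types (v : place K).
Local Notation Q v := ((residue_card v)%:R : R).

(** The weight of a pole of order [j > 0] is [loc_a v ^+ j]; the weight of
    integrality at [v] is [loc_b v], which differs from 1 only at the zeros of
    [f]. *)
Definition loc_a v : R[i] := cpow (Q v) (- s).
Definition loc_b v : R[i] := cpow (Q v `^ ((excess f v)%:R / d%:R)) (- s).

Let Re_N : complex.Re (- s) = - complex.Re s. Proof. by rewrite raddfN. Qed.

Lemma excess_le v : (excess f v <= d)%N.
Proof. by rewrite /excess; have := hfd v; lia. Qed.

Lemma normc_loc_a v : normc (loc_a v) = Q v `^ (- complex.Re s).
Proof. by rewrite normc_cpow ?residue_card_gt0 // Re_N. Qed.

Lemma residue_card_ge1 v : 1 <= Q v.
Proof. by rewrite ler1n (leq_trans _ (residue_card_ge2 v)). Qed.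

Lemma normc_loc_b v : normc (loc_b v) = Q v `^ (- (complex.Re s * ((excess f v)%:R / d%:R))).
Proof.
rewrite normc_cpow ?powR_gt0 ?residue_card_gt0 // Re_N -powRrM; congr (_ `^ _); ring.
Qed.

Let d0 : 0 < d%:R :> R. Proof. by rewrite ltr0n; lia. Qed.

Let ratio01 v : 0 <= ((excess f v)%:R / d%:R : R) <= 1.
Proof.
by rewrite divr_ge0 //= ler_pdivrMr // mul1r ler_nat excess_le.
Qed.

Lemma loc_ab v : normc (loc_a v) <= normc (loc_b v).
Proof.
rewrite normc_loc_a normc_loc_b ler_powR ?residue_card_ge1 // lerN2 -[leRHS]mulr1.
by have /andP[_ h2] := ratio01 v; apply: ler_wpM2l => //; move: hs; lra.
Qed.

Lemma loc_b1 v : normc (loc_b v) <= 1.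
Proof.
rewrite normc_loc_b -[leRHS](powRr0 (Q v)) ler_powR ?residue_card_ge1 // oppr_le0.
by have /andP[h1 _] := ratio01 v; apply: mulr_ge0 => //; move: hs; lra.
Qed.

Lemma loc_b_out v : excess f v = 0%N -> loc_b v = 1.
Proof. by move=> e; rewrite /loc_b e mul0r powRr0 cpow1. Qed.

Lemma loc_rhoE v : loc_a v * (residue_card v)%:R = cpow (Q v) (- (s - 1)).
Proof.
have q0 := residue_card_gt0 R v.
rewrite opprB addrC cpowD //; congr (_ * _).
have := cpow_powR 1 1 q0; rewrite powRr1 ?(ltW q0) // mulr1 => <-.
rewrite /cpow /= powRr1 ?(ltW q0) // mul0r cos0 sin0 -(rmorph_nat (real_complex R)).
by apply/eqP; rewrite eq_complex /=; apply/andP; split; apply/eqP; ring.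
Qed.

Lemma normc_loc_rho v : normc (loc_a v * (residue_card v)%:R) = Q v `^ (- (complex.Re s - 1)).
Proof.
rewrite loc_rhoE normc_cpow ?residue_card_gt0 // raddfN raddfB /=; congr (_ `^ _).
Qed.

Lemma powR_le_half v (t : R) : 1 <= t -> Q v `^ (- t) <= 2^-1.
Proof.
move=> t1; have q0 := residue_card_gt0 R v.
apply: (@le_trans _ _ (Q v `^ (-1))); first by rewrite ler_powR ?residue_card_ge1 ?lerN2.
rewrite powR_inv1 ?(ltW q0) // lef_pV2 ?posrE //.
by rewrite (ler_nat R 2) residue_card_ge2.
Qed.

Lemma loc_weightE v x :
  cpow (Q v `^ local_exponent R d f v x) (- s) =
  if pole_order v x is 0%N then loc_b v else loc_a v ^+ pole_order v x.
Proof.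
have q0 := residue_card_gt0 R v.
rewrite /local_exponent; case: (pole_order v x) => [|j] //=.
by rewrite powR_mulrn ?(ltW q0) // cpowX.
Qed.

Lemma u_powX v n : u_ d s v ^+ n = cpow (Q v `^ (n%:R / d%:R)) (- s).
Proof.
have q0 : 0 < #|F|%:R :> R by rewrite ltr0n (leq_trans _ (finNzRing_gt1 F)).
rewrite /u_ -cpow_nat // /residue_card natrX -powR_mulrn ?(ltW q0) // -powRrM cpow_powR //.
congr cpow; rewrite rmorphM fmorph_div !rmorph_nat; ring.
Qed.

Lemma u_pow_excess v : u_ d s v ^+ excess f v = loc_b v.
Proof. exact: u_powX. Qed.

Lemma u_pow_d v : u_ d s v ^+ d = loc_a v.
Proof. by rewrite u_powX divff ?gt_eqF // powRr1 // ltW // residue_card_gt0. Qed.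

End LocalFactors.

Theorem theorem1p1 (R : realType) (F : finFieldType)
    (K : fieldExtType {fraction {poly F}}) (hK : full_constant_field K)
    (g : nat) (hgenus : is_genus K g) (hg : g = 0%N \/ g = 1%N)
    (d : nat) (hd : (2 <= d)%N)
    (f : K) (hfO : f \in integers K) (hfd : forall v : place K, (val v f < (d%:Z)%:E)%E)
    (s : R[i]) (hs : 2 < complex.Re s) :
  let q : R[i] := #|F|%:R in
  let S : set (place K) := [set v | (0 < val v f)%E] in
  let vf (v : place K) : int := fine (val v f) in
  let qv (v : place K) : R[i] := (residue_card v)%:R in
  let u (v : place K) : R[i] := u_ d s v in
  let phi : {poly K} := 'X^d + (f^-1)%:P in
  let c : R[i] := if g == 1%N then q - 1 else 0 in
  cvg (partial_sum (height_zeta_term phi s) @ totally) /\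
  height_zeta phi s =
    q ^ (1 - g%:Z) * (dedekind_zeta K (s - 1) / dedekind_zeta K s) *
      (\big[*%R/1]_(v \in S)
         ((u v ^ vf v + (qv v - 1) * u v ^+ d - qv v * u v ^ (d%:Z + vf v))
            / (1 - u v ^+ d)))
    + c / dedekind_zeta K s *
      (\big[*%R/1]_(v \in S)
         ((u v ^ vf v - u v ^+ d) / (1 - u v ^+ d))).
Proof.
move=> q S vf qv u phi c.
have [v0 _] := @place_inhabited F K.
have f0 : f != 0.
  by apply/eqP => f0; have := hfd v0; rewrite f0 val_zero.
have hfd' v : ord v f < d%:Z by have := hfd v; rewrite val_ord // lte_fin.
have SE : S = [set v | 0 < ord v f].
  by apply/seteqP; split=> v; rewrite /S /= val_ord // lte_fin.
have finS : finite_set S by rewrite SE; exact: finite_zeros.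
pose Sf := fset_set S.
have SfP v : (v \in Sf) = (0 < ord v f).
  by rewrite in_fset_set // SE; apply/idP/idP => [/set_mem|/mem_set].
have exS v : v \notin Sf -> excess f v = 0%N.
  by rewrite SfP -leNgt /excess => h; rewrite max_l.
pose a := @loc_a R F K s; pose b := @loc_b R F K d f s.
pose rho v : R[i] := a v * qv v.
have rho2 v : normc (rho v) <= 2^-1.
  by rewrite normc_loc_rho; apply: powR_le_half; lra.
have [M1 hM1] := @sum_residue_card R F K hK g hgenus (complex.Re s - 1) ltac:(lra).
have [M2 hM2] := @sum_residue_card R F K hK g hgenus (complex.Re s) ltac:(lra).
have rhoM (A : {fset place K}) : \sum_(v <- A) normc (rho v) <= M1.
  by apply: le_trans (hM1 A); apply: ler_sum => v _; rewrite -normc_loc_rho.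
have aM (A : {fset place K}) : \sum_(v <- A) normc (a v) <= M2.
  by apply: le_trans (hM2 A); apply: ler_sum => v _; rewrite -normc_loc_a.
have a2 v : normc (a v) <= 2^-1.
  by rewrite normc_loc_a; apply: powR_le_half; lra.
have hE (x : K) (A : {fset place K}) : (Sf `<=` A)%fset ->
    (forall v, v \notin A -> pole_order v x = 0%N) ->
    height_zeta_term phi s x = \prod_(v <- A) (if pole_order v x is 0%N then b v else a v ^+ pole_order v x).
  move=> SA hx; rewrite /height_zeta_term.
  rewrite (@canonical_heightE R F K d hd f f0 hfd' x A); last first.
    move=> v vA; split; first exact: hx.
    by apply: exS; apply: contra vA; exact: (fsubsetP SA).
  rewrite cpow_prod => [|v]; last by rewrite powR_gt0 // residue_card_gt0.
  by apply: eq_bigr => v _; exact: loc_weightE.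
have [Z [hZ hZ']] := cvg_euler_sum hK hgenus hg (loc_ab hd hfd' hs) (loc_b1 hd hfd' hs) rho2 hE rhoM.
have [lz [lz0 hz hzV]] := euler_product a2 aM.
have [lz1 [_ hz1 _]] := euler_product rho2 rhoM.
have na v : 1 - a v != 0.
  by apply/eqP => e; have := le_normcD (1 - a v) (a v); have := a2 v;
    rewrite subrK normc1 e normc0; lra.
have nr v : 1 - rho v != 0.
  by apply/eqP => e; have := le_normcD (1 - rho v) (rho v); have := rho2 v;
    rewrite subrK normc1 e normc0; lra.
pose e v : R[i] := (b v + (qv v - 1) * a v - qv v * (a v * b v)) / (1 - a v).
pose m v : R[i] := (b v - a v) / (1 - a v).
have bS v : v \notin Sf -> b v = 1 by move=> /exS; exact: loc_b_out.
have prodS (G : place K -> R[i]) (A : {fset place K}) : (Sf `<=` A)%fset ->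
    (forall v, v \notin Sf -> G v = 1) -> \prod_(v <- A) G v = \prod_(v <- Sf) G v.
  move=> SA G1; rewrite (big_fset_sub _ _ SA) /=.
  have -> : \prod_(v <- (A `\` Sf)%fset) G v = 1; last by rewrite mulr1.
  by rewrite big_seq big1 // => v; rewrite inE => /andP[/G1].
have eS v : v \notin Sf -> e v = 1.
  by move=> /bS; rewrite /e => ->; field; exact: na.
have mS v : v \notin Sf -> m v = 1 by move=> /bS; rewrite /m => ->; rewrite divff.
pose Pe := \prod_(v <- Sf) e v; pose Pm := \prod_(v <- Sf) m v.
pose Qg : R[i] := (#|F| ^ (1 - g))%:R.
pose cg : R[i] := if g == 1%N then (#|F| - 1)%:R else 0.
have ZE : Z = Qg * (lz^-1 * lz1 * Pe) + cg * (lz^-1 * Pm).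
  apply: (cvgC_unique (totally_proper _) hZ').
  pose G (A : {fset place K}) : R[i]^o := Qg * (\prod_(v <- A) (1 - a v) *
     \prod_(v <- A) (1 - rho v)^-1 * Pe) + cg * (\prod_(v <- A) (1 - a v) * Pm).
  apply: (@cvg_totally_eq _ _ Sf G).
    move=> A SA; rewrite /G /euler_sum /Pe /Pm -(prodS e A SA eS) -(prodS m A SA mS).
    rewrite -!big_split /=; congr (_ * _ + _ * _); apply: eq_bigr => v _.
      have := na v; have := nr v; rewrite /e /rho /qv -/(a v) -/(b v).
      move: (a v) (b v) (_%:R : R[i]) => x y z n1 n2.
      by field; rewrite n1 n2.
    by rewrite /m mulrC divfK.
  have TP := totally_proper (place K).
  have cst (l : R[i]^o) : ((fun=> l) : {fset place K} -> R[i]^o) @ totally --> l.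
    exact: (cvgC_cst TP).
  have h1 := cvgC_mul TP (cst Qg) (cvgC_mul TP (cvgC_mul TP hzV hz1) (cst Pe)).
  have h2 := cvgC_mul TP (cst cg) (cvgC_mul TP hzV (cst Pm)).
  exact: (cvgC_add TP h1 h2).
have limE (T : choiceType) (w : {fset T} -> R[i]^o) (l : R[i]^o) : w @ totally --> l ->
    lim (w @ totally) = l.
  by move=> hw; exact: (@cvg_lim _ (@norm_hausdorff _ (R[i]^o)) _ _ (totally_proper T) _ _ hw).
have hs1 : dedekind_zeta K s = lz by exact: (limE _ _ _ hz).
have hs2 : dedekind_zeta K (s - 1) = lz1.
  rewrite /dedekind_zeta (_ : (fun A : {fset place K} => _) =
    fun A : {fset place K} => \prod_(v <- A) (1 - rho v)^-1 : R[i]^o).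
    exact: (limE _ _ _ hz1).
  by apply/funext => A; apply: eq_bigr => v _; rewrite /rho /a loc_rhoE.
split; first by apply: cvgP hZ.
have -> : height_zeta phi s = Z by exact: (limE _ _ _ hZ).
rewrite ZE hs1 hs2.
have uvf v : v \in Sf -> u v ^ vf v = b v.
  move=> vS; rewrite /b -u_pow_excess exprnP; congr (_ ^ _).
  by move: vS; rewrite SfP /excess /vf -/(ord v f) => h; rewrite max_r ?ltW //; lia.
have u0 v : u v != 0 by apply: cpow_neq0; rewrite ltr0n (leq_trans _ (finNzRing_gt1 F)).
rewrite !fsbig_finite // -/Sf.
have -> : \prod_(v <- Sf) ((u v ^ vf v + (qv v - 1) * u v ^+ d - qv v * u v ^ (d%:Z + vf v))
            / (1 - u v ^+ d)) = Pe.
  apply: eq_big_seq => v vS; rewrite expfzDr // uvf // -exprnP.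
  by rewrite /u u_pow_d.
have -> : \prod_(v <- Sf) ((u v ^ vf v - u v ^+ d) / (1 - u v ^+ d)) = Pm.
  by apply: eq_big_seq => v vS; rewrite uvf // /u u_pow_d.
have -> : q ^ (1 - g%:Z) = Qg.
  by rewrite /Qg /q; case: hg => ->; rewrite ?subr0 ?subrr ?expr1z ?expr0z ?subn0 ?expn1.
have -> : c = cg.
  by rewrite /c /cg /q; case: ifP => // _; rewrite natrB // ltnW // finNzRing_gt1.
ring.
Qed.
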